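(* Let $S:[-1,1]\to[-1,1]$ be a map in the class described in the context with $\gamma>1$ and $0<\kappa<\frac1{\gamma-1}$ (or $0<\kappa<1$ when $\gamma\le2$), and let $\rho$ be the density of its absolutely continuous invariant probability measure $\mu$. Then: - when $x\to1$, the density $\rho(x)\to0$; - when $x\to-1$, the density satisfies: (i) if $\kappa=\frac1\gamma$, then $\rho=\mathcal{O}(1)$; (ii) if $\frac1\gamma<\kappa$, then $\rho\to\infty$; (iii) if $\frac1\gamma>\kappa$, then $\rho\to0$; - the density is always of order $1$ in the neighborhood of $0$.
   Context: The class of maps: $\kappa\in(0,1)$ and $\gamma>1$ are two parameters, $a,b>0$, and $S$ maps $[-1,1]$ onto itself with two surjective branches, defined on the half intervals $[-1,0]$ and $[0,1]$ and symmetric to each other ($S(-x)=S(x)$), with the following local behaviour (where $\sim$ denotes the leading local behaviour, including the displayed power term): $$S(x)\sim 1-b|x|^{\kappa}\ (x\approx0),\qquad S(x)\sim -x+a|x-1|^{\gamma}\ (x\approx1_-),\qquad S(x)\sim x+a|x+1|^{\gamma}\ (x\approx-1_+).$$ Moreover (i) at all points $x\neq-1,1$ the absolute value of the derivative is strictly bigger than $1$ (at the cusp $0$ the left and right first derivatives diverge to $\pm\infty$); (ii) $S$ is strictly increasing on $[-1,0]$, strictly decreasing on $[0,1]$, and convex on each of the intervals $(-1,0)$ and $(0,1)$. The fixed point $-1$ is parabolic. Under the stated condition on $\kappa,\gamma$, $S$ has an absolutely continuous invariant probability measure $\mu$, and $\rho$ is its density with respect to Lebesgue measure. ''Of order $1$''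 means bounded above and bounded away from $0$. *)

(* Defs.v *)
From HB Require Import structures.
From mathcomp Require Import all_boot all_order all_algebra.
From mathcomp Require Import all_classical all_reals all_analysis.

Set Implicit Arguments.
Unset Strict Implicit.
Unset Printing Implicit Defensive.

Import Order.TTheory GRing.Theory Num.Theory.
Import numFieldNormedType.Exports.

Local Open Scope classical_set_scope.
Local Open Scope ring_scope.

(* The maps are total functions R -> R; only the values on [-1, 1] matter.
   The fields cusp_left and cusp_right spell out the divergence of the one-sided
   derivatives at the cusp.  The values S (-1) = -1, S 0 = 1, S 1 = -1 and the
   continuity of S on [-1, 1] follow from monotonicity and surjectivity. *)
Record parabolic_cusp_map (R : realType) (kappa gamma a b : R) (S : R -> R)
    : Prop := ParabolicCuspMap {
  left_onto : S @` `[-1, 0] = `[-1, 1]%classic;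
  right_onto : S @` `[0, 1] = `[-1, 1]%classic;
  branches_symmetric : {in `[-1, 1], forall x, S (- x) = S x};
  equiv_at_0 :
    (fun x : R => 1 - S x) ~_ (0^') (fun x : R => b * `|x| `^ kappa);
  equiv_at_1 :
    (fun x : R => S x - (- x)) ~_ (1^'-) (fun x : R => a * `|x - 1| `^ gamma);
  equiv_at_N1 :
    (fun x : R => S x - x) ~_ ((-1)^'+) (fun x : R => a * `|x + 1| `^ gamma);
  expanding : forall x : R, -1 < x < 1 -> x != 0 ->
    derivable S x 1 /\ 1 < `|derive1 S x|;
  cusp_left : derive1 S x @[x --> 0^'-] --> +oo;
  cusp_right : derive1 S x @[x --> 0^'+] --> -oo;
  left_increasing : {in `[-1, 0] &, {homo S : x y / x < y}};
  right_decreasing : {in `[0, 1] &, {homo S : x y /~ x < y}};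
  left_convex : @convex_function R R^o `]-1, 0[%classic S;
  right_convex : @convex_function R R^o `]0, 1[%classic S
}.

(* The phase space is [-1, 1], hence the mass condition and the restriction of
   the preimage to [-1, 1]. *)
Definition acip (R : realType) (S : R -> R)
    (mu : probability (measurableTypeR R) R) : Prop :=
  [/\ mu `[-1, 1]%classic = 1%E,
      forall A : set (measurableTypeR R), measurable A ->
        mu (`[-1, 1] `&` S @^-1` A) = mu A
    & mu `<< lebesgue_measure ].

Definition is_density (R : realType) (mu : probability (measurableTypeR R) R)
    (rho : R -> R) : Prop :=
  [/\ measurable_fun setT rho, forall x, 0 <= rho x
    & forall A : set (measurableTypeR R), measurable A ->
        mu A = (\int[lebesgue_measure]_(x in A) (rho x)%:E)%E ].

(* A density is only defined up to a Lebesgue-null set, so its behaviour near a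
   point is expressed along ess F, the filter generated by F and the sets of
   full Lebesgue measure: limits along ess F are essential limits along F. *)
Definition ess (R : realType) (F : set_system R) : set_system R :=
  [set A | exists2 B, F B &
     {ae @lebesgue_measure R, forall x, B x -> A x}].

#[global] Instance ess_filter (R : realType) (F : set_system R) :
  Filter F -> Filter (ess F).
Proof.
move=> FF.
have Fae : Filter (nbhs (almost_everywhere (@lebesgue_measure R))).
  exact: ae_filter_ringOfSetsType.
split.
- by exists setT; [exact: filterT | exact: aeW].
- move=> A B [A' FA' HA] [B' FB' HB]; exists (A' `&` B'); first exact: filterI.
  by move: HA HB; apply: filterS2 => x HAx HBx [/HAx ? /HBx ?].
- move=> A B sAB [A' FA' HA]; exists A' => //.
  by move: HA; apply: filterS => x HAx /HAx /sAB.
Qed.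

Definition of_order_one (R : realType) (F : set_system R) (f : R -> R) : Prop :=
  exists c C : R, 0 < c /\ \forall x \near F, c <= f x <= C.

Canonical ess_filter_on (R : realType) (F : filter_on R) :=
  FilterType (ess F) (ess_filter _).

(* Main.v *)
(* The inverse psi of the left branch is concave, hence has a nonincreasing slope D,
   and the transfer operator is P f = D * (f o psi + f o -psi). Call f controlled by a
   nonincreasing u if |f x - f y| <= u x - u y for x <= y. Splitting D at a small level
   gives a control u' of P f with
     int (1 - x) u' + c u(s) <= int (1 - x) u + C int f,
   the term c u(s) being gained because the branch lies above the diagonal. Iterating P
   from step functions close to rho thus produces, for every s > -1, approximations of mu
   with controls bounded uniformly at s. It follows that mu <= C Leb on [s, 1] and that
   mu >= c Leb on some interval, whose images grow until one of them contains 0; this is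
   the order 1 behaviour at 0. By invariance the density near 1 is comparable to D,
   that is to (1 - x)^(1/kappa - 1). Near -1 invariance reads
   rho = D * (rho o psi) + D * (rho o -psi), the last term being comparable to
   D(x) D(- psi x) ~ (1 + x)^(1/kappa - 1), whereas 1 - D(x) ~ (1 + x)^(gamma - 1);
   constants K with K (1 - D(x)) above or below that term are upper or lower bounds of
   rho, which makes rho behave like (1 + x)^(1/kappa - gamma). *)
Require Import Defs.
From HB Require Import structures.
From mathcomp Require Import all_boot all_order all_algebra.
From mathcomp Require Import all_classical all_reals all_analysis.
From mathcomp Require Import measurable_realfun ring lra.

Set Implicit Arguments.
Unset Strict Implicit.
Unset Printing Implicit Defensive.

Import Order.TTheory GRing.Theory Num.Theory.
Import numFieldNormedType.Exports.

Local Open Scope classical_set_scope.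
Local Open Scope ring_scope.

(** The neutral fixed point is the obstacle: the branch does not expand at -1 and [rho] may be
    unbounded there, so a bound on the total variation over [-1, 1] cannot be hoped for. A control
    replaces it because [u s] speaks of the variation on [s, 1] only. Nothing is contracted: one
    step raises the weighted integral [cost u] by at most a multiple of the mass, while a large
    [u s] makes it drop, which cannot last for a nonnegative quantity. The iterates stay close to
    [mu] because the transfer operator keeps an approximation of an invariant measure exactly as
    accurate as it was. As [rho] is defined up to null sets, all bounds are inequalities between
    [mu B] and multiples of [lam B] (or of the integral of [D] over [B]) for Borel sets [B] inside
    (-1, 1); they become bounds on [rho] only at the very end. *)

(** * Integration against a measure given by a density *)

Section density.
Context d (T : measurableType d) (R : realType).
Variables (mu : {sigma_finite_measure set T -> \bar R}) (h : T -> R).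

(** The proofs are carried as arguments so that the measure instances, which depend on them, can be
    inferred from the term itself. *)
Definition density_measure & (forall x, 0 <= h x)
    & mu.-integrable setT (EFin \o h) :=
  fun A : set T => (\int[mu]_(x in A) (h x)%:E)%E.

Hypotheses (h0 : forall x, 0 <= h x) (ih : mu.-integrable setT (EFin \o h)).
Local Notation nu := (density_measure h0 ih).

Let density0 : nu set0 = 0%E.
Proof. by rewrite /density_measure integral_set0. Qed.

Let density_ge0 A : (0 <= nu A)%E.
Proof. by apply: integral_ge0 => x _; rewrite lee_fin. Qed.

Let density_sigma_additive : semi_sigma_additive nu.
Proof.
apply: semi_sigma_additive_nng_induced => [|x]; last by rewrite lee_fin.
by case/integrableP : ih.
Qed.

HB.instance Definition _ := isMeasure.Build _ _ _ nu
  density0 density_ge0 density_sigma_additive.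

Let density_finite : fin_num_fun nu.
Proof.
move=> A mA; apply: integrable_fin_num => //.
by apply: (integrableS measurableT).
Qed.

HB.instance Definition _ := Measure_isFinite.Build _ _ _ nu
  density_finite.

(** Change of variables holds for the Radon-Nikodym derivative of [nu], and this derivative agrees
    almost everywhere with [h] because both have the same integral over every measurable set. *)
Lemma ge0_integral_density (E : set T) (g : T -> \bar R) :
  measurable E -> measurable_fun E g -> (forall x, 0 <= g x)%E ->
  (\int[nu]_(x in E) g x = \int[mu]_(x in E) (g x * (h x)%:E))%E.
Proof.
move=> mE mg g0.
have dom : nu `<< mu.
  apply/null_content_dominatesP => A mA A0; rewrite /density_measure.
  apply: null_set_integral => //.
  by apply: measurable_funTS; case/integrableP : ih.
have ih2 := Radon_Nikodym_SigmaFinite.f_integrable dom.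
rewrite -(Radon_Nikodym_SigmaFinite.change_of_variables dom)//.
apply: ae_eq_integral => //.
- by apply: emeasurable_funM => //; apply: measurable_funTS; case/integrableP : ih2.
- by apply: emeasurable_funM => //; apply: measurable_funTS; case/integrableP : ih.
- apply: ae_eqe_mul2l; apply: integral_ae_eq => //.
  + exact: integrableS ih2.
  + by apply: measurable_funTS; case/integrableP : ih.
  + by move=> A _ mA; rewrite -Radon_Nikodym_SigmaFinite.f_integral.
Qed.

End density.

(** * Slopes of a concave function and their integrals *)

Section slopes.
Context (R : realType).
Variables (F D : R -> R).
Hypotheses (D0 : forall x, 0 <= D x)
  (slope_ge : forall x y, x <= y -> D y * (y - x) <= F y - F x)
  (slope_le : forall x y, x <= y -> F y - F x <= D x * (y - x)).

Lemma slope_nonincreasing : {homo D : x y /~ x <= y}.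
Proof.
move=> y x; rewrite le_eqVlt => /predU1P[->//|xy].
rewrite -(@ler_pM2r _ (y - x)) ?subr_gt0//.
exact: le_trans (slope_ge (ltW xy)) (slope_le (ltW xy)).
Qed.

Lemma measurable_slope A : measurable A -> measurable_fun A D.
Proof. by move=> mA; apply: nonincreasing_measurable => // x y; exact: slope_nonincreasing. Qed.

Lemma integral_slope_bounds x y : x <= y ->
  (((D y * (y - x))%:E <= \int[lebesgue_measure]_(t in `]x, y]) (D t)%:E) /\
   (\int[lebesgue_measure]_(t in `]x, y]) (D t)%:E <= (D x * (y - x))%:E))%E.
Proof.
move=> xy.
have mI : measurable (`]x, y]%classic : set (measurableTypeR R)) by [].
have lI : lebesgue_measure (`]x, y]%classic : set R) = (y - x)%:E.
  rewrite lebesgue_measure_itv/= lte_fin; move: xy; rewrite le_eqVlt.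
  by case/predU1P => [->|->]; rewrite ?ltxx ?subrr// EFinB.
have mD : measurable_fun `]x, y]%classic (EFin \o D).
  by apply/measurable_EFinP; exact: measurable_slope.
split.
- rewrite EFinM -lI -(integral_cst lebesgue_measure mI).
  apply: ge0_le_integral => // t.
    by move=> _; rewrite lee_fin.
  by rewrite /= in_itv/= => /andP[_ ty]; rewrite lee_fin slope_nonincreasing.
- rewrite EFinM -lI -(integral_cst lebesgue_measure mI).
  apply: ge0_le_integral => // t.
    by move=> _; rewrite lee_fin.
  by rewrite /= in_itv/= => /andP[xt _]; rewrite lee_fin slope_nonincreasing// ltW.
Qed.

Lemma integral_slope_split x y z : x <= y -> y <= z ->
  (\int[lebesgue_measure]_(t in `]x, z]) (D t)%:E =
   \int[lebesgue_measure]_(t in `]x, y]) (D t)%:E +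
   \int[lebesgue_measure]_(t in `]y, z]) (D t)%:E)%E.
Proof.
move=> xy yz; rewrite (@itv_bndbnd_setU _ _ _ (BRight y)) ?bnd_simp//.
rewrite ge0_integral_setU//.
- by apply/measurable_EFinP; apply: measurable_slope; exact: measurableU.
- by move=> t _; rewrite lee_fin.
- apply/disj_setPS => t /= []; rewrite !in_itv/= => /andP[_ ty] /andP[yt _].
  by move: (lt_le_trans yt ty); rewrite ltxx.
Qed.

(* Telescoping over [n] cells of length [h]: the error is at most [h * (D x - D y)]. *)
Lemma integral_slope x y : x <= y ->
  (\int[lebesgue_measure]_(t in `]x, y]) (D t)%:E = (F y - F x)%:E)%E.
Proof.
pose I x y := fine (\int[lebesgue_measure]_(t in `]x, y]) (D t)%:E)%E.
have IE u v : u <= v -> (\int[lebesgue_measure]_(t in `]u, v]) (D t)%:E = (I u v)%:E)%E.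
  move=> uv; rewrite fineK// ge0_fin_numE ?integral_ge0//; last first.
    by move=> t _; rewrite lee_fin.
  exact: le_lt_trans (integral_slope_bounds uv).2 (ltry _).
have step u h n : 0 <= h ->
    `|I u (u + h *+ n) - (F (u + h *+ n) - F u)| <= h * (D u - D (u + h *+ n)).
  move=> h0; elim: n => [|n IH].
    rewrite mulr0n addr0 !subrr subr0 mulr0 normr_le0; apply/eqP.
    by rewrite /I set_itvoc0 integral_set0.
  set v := u + h *+ n in IH *.
  have uv : u <= v by rewrite lerDl mulrn_wge0.
  have vw : v <= v + h by rewrite lerDl.
  have -> : u + h *+ n.+1 = v + h by rewrite mulrSr addrA.
  have -> : I u (v + h) = I u v + I v (v + h).
    apply: EFin_inj; rewrite EFinD -!IE ?(le_trans uv vw)//.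
    exact: integral_slope_split.
  have [] := integral_slope_bounds vw; rewrite IE// !lee_fin => b1 b2.
  have := slope_ge vw; have := slope_le vw.
  rewrite (_ : v + h - v = h) in b1 b2 *; last by ring.
  move=> b3 b4; move: IH; rewrite !ler_norml => /andP[c1 c2].
  by apply/andP; split; lra.
move=> xy; rewrite IE//; congr EFin.
apply/eqP; rewrite -subr_eq0 -normr_le0; apply/ler_addgt0Pl => e e0; rewrite addr0.
pose c := (y - x) * (D x - D y).
have c0 : 0 <= c by rewrite mulr_ge0// subr_ge0// slope_nonincreasing.
(* With [n] cells the error is [c / n]; the successor keeps [n] nonzero. *)
pose n := (Num.Def.archi_bound (c / e)).+1.
have := step x ((y - x) / n%:R) n; rewrite divr_ge0 ?subr_ge0// => /(_ isT).
have n0 : (n%:R : R) != 0 by rewrite pnatr_eq0.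
rewrite -[_ *+ n]mulr_natr divfK// (addrC x) subrK => /le_trans; apply.
rewrite mulrAC -/c ler_pdivrMr ?ltr0n// mulrC -ler_pdivrMr//.
apply: ltW; apply: lt_le_trans (archi_boundP _) _; first by rewrite divr_ge0// ltW.
by rewrite ler_nat.
Qed.

End slopes.

(* [sigma] is the left branch [-1, 0] -> [-1, 1] of the map, [psi] its inverse
   and [D] a one-sided derivative of the concave function [psi]; all three are
   extended to the real line so that [psi] remains concave with slope 1 on the
   left of -1 and 0 on the right of 1. *)
Record cusp_branch (R : realType) (sigma psi D : R -> R) : Prop := CuspBranch {
  branch_nondecreasing : {homo sigma : x y / x <= y};
  branchK : forall y, y <= 0 -> psi (sigma y) = y;
  branch_invK : forall x, x <= 1 -> sigma (psi x) = x;
  branch_inv_le0 : forall x, psi x <= 0;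
  branch_inv_N1 : forall x, x <= -1 -> psi x = x;
  branch_inv_1 : forall x, 1 <= x -> psi x = 0;
  branch_inv_lt : forall x, -1 < x -> psi x < x;
  slope_ge0 : forall x, 0 <= D x;
  slope_le1 : forall x, D x <= 1;
  slope_1 : forall x, 1 <= x -> D x = 0;
  slope_small : forall e, 0 < e -> exists t, -1 < t < 1 /\ D t <= e;
  chord_ge : forall x y, x <= y -> D y * (y - x) <= psi y - psi x;
  chord_le : forall x y, x <= y -> psi y - psi x <= D x * (y - x) }.

(** * Change of variables along the inverse of the left branch *)

Section branch.
Context (R : realType) (sigma psi D : R -> R).
Hypothesis br : cusp_branch sigma psi D.
Notation lam := (@lebesgue_measure R).

Lemma slope_nd : {homo D : x y /~ x <= y}.
Proof. exact: slope_nonincreasing (chord_ge br) (chord_le br). Qed.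

Lemma branch_inv_nd : {homo psi : x y / x <= y}.
Proof.
move=> x y xy; rewrite -subr_ge0; apply: le_trans (chord_ge br xy).
by rewrite mulr_ge0 ?subr_ge0// (slope_ge0 br).
Qed.

Lemma branch_inv_le x : psi x <= x.
Proof.
have [x1|x1] := leP x (-1); first by rewrite (branch_inv_N1 br).
by apply: ltW; exact: (branch_inv_lt br).
Qed.

Lemma branch0 : sigma 0 = 1.
Proof. by rewrite -(branch_inv_1 br (lexx 1)) (branch_invK br). Qed.

Lemma branchN1 : sigma (-1) = -1.
Proof.
by rewrite -{1}(branch_inv_N1 br (lexx (-1))) (branch_invK br)// lerN10 ?ler0N1//; lra.
Qed.

Lemma branch_le1 y : y <= 0 -> sigma y <= 1.
Proof. by rewrite -branch0; exact: (branch_nondecreasing br). Qed.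

Lemma branch_geN1 y : -1 <= y -> -1 <= sigma y.
Proof. by move=> /(branch_nondecreasing br); rewrite branchN1. Qed.

Lemma branch_ge y : y <= 0 -> y <= sigma y.
Proof. by move=> y0; rewrite -{1}(branchK br y0) branch_inv_le. Qed.

Lemma lt_branch_inv c x : c <= 0 -> x <= 1 -> (c < psi x) = (sigma c < x).
Proof.
move=> c0 x1; rewrite !ltNge; congr negb; apply/idP/idP => h.
  by rewrite -(branch_invK br x1); exact: (branch_nondecreasing br).
by rewrite -(branchK br c0); exact: branch_inv_nd.
Qed.

Lemma measurable_branch_inv A : measurable A -> measurable_fun A psi.
Proof. by move=> mA; apply: nondecreasing_measurable => // x y; exact: branch_inv_nd. Qed.

Lemma measurable_branch A : measurable A -> measurable_fun A sigma.
Proof.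
by move=> mA; apply: nondecreasing_measurable => // x y; exact: (branch_nondecreasing br).
Qed.

Lemma measurable_D A : measurable A -> measurable_fun A D.
Proof. exact: measurable_slope (chord_ge br) (chord_le br) _. Qed.

(** Open on the left and closed on the right, like the intervals []a, b]] of the semiring on which
    two measures are compared below. *)
Let J : set (measurableTypeR R) := `]-1, 1]%classic.
Let K : set (measurableTypeR R) := `]-1, 0]%classic.

(** Clamping makes the formula valid for all [a] and [b]. Only the left end has to be clamped at -1,
    since a right end below -1 yields an empty interval on both sides. *)
Lemma branch_inv_preimage a b : psi @^-1` `]a, b] `&` J =
  `]sigma (Num.max (Num.min a 0) (-1)), sigma (Num.min b 0)]%classic.
Proof.
have c0 : Num.max (Num.min a 0) (-1) <= 0 by rewrite ge_max ge_min lexx orbT/=; lra.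
have d0 : Num.min b 0 <= 0 by rewrite ge_min lexx orbT.
apply/seteqP; split => x /=; rewrite /J /= !in_itv/=.
- move=> [/andP[h1 h2] /andP[h3 h4]].
  have ps : -1 < psi x by rewrite lt_branch_inv ?branchN1//; lra.
  rewrite -lt_branch_inv// [X in _ && X]leNgt -lt_branch_inv// -leNgt.
  by rewrite gt_max ps gt_min h1 le_min h2 (branch_inv_le0 br).
- move=> /andP[h1 h2].
  have x1 : x <= 1 by exact: le_trans h2 (branch_le1 d0).
  move: h1 h2; rewrite -lt_branch_inv// [X in _ -> is_true X -> _]leNgt -lt_branch_inv// -leNgt.
  rewrite gt_max gt_min le_min [0 < _]ltNge (branch_inv_le0 br) orbF => /andP[-> ps] /andP[-> _].
  split=> //; rewrite x1 andbT -branchN1 -lt_branch_inv//; lra.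
Qed.

Lemma setI_left_half a b : (`]a, b] `&` K =
  `]Num.max (Num.min a 0) (-1), Num.min b 0])%classic.
Proof.
apply/seteqP; split => x /=; rewrite /K /= !in_itv/= gt_max gt_min le_min.
- by move=> [/andP[-> ->] /andP[-> ->]].
- by move=> /andP[/andP[h1 ->] /andP[-> x0]]; move: h1; rewrite [0 < _]ltNge x0 orbF => ->.
Qed.

Lemma integral_slopeE x y : x <= y ->
  (\int[lam]_(t in `]x, y]) (D t)%:E = (psi y - psi x)%:E)%E.
Proof. exact: (integral_slope (slope_ge0 br) (chord_ge br) (chord_le br)). Qed.

(** The image under [psi] of the measure with density [D] on [J] is Lebesgue measure on [K]. By
    uniqueness this only has to be checked on intervals, where the integral of [D] is an increment
    of [psi]. *)
Lemma ge0_integral_branch_inv (g : R -> \bar R) :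
  measurable_fun setT g -> (forall y, 0 <= g y)%E ->
  (\int[lam]_(x in J) (g (psi x) * (D x)%:E) = \int[lam]_(y in K) g y)%E.
Proof.
move=> mg g0.
pose h := D \_ J.
have hE x : x \in J -> h x = D x by rewrite /h patchE => ->.
have h0 x : 0 <= h x.
  by rewrite /h patchE; case: ifP => // _; exact: (slope_ge0 br).
have hEF : EFin \o h = (EFin \o D) \_ J.
  by apply/funext => x; rewrite /= /h !patchE; case: ifP.
have N11 : (-1 : R) <= 1 by lra.
have mJ : measurable J by exact: measurable_itv.
have mK : measurable K by exact: measurable_itv.
have ih : lam.-integrable setT (EFin \o h).
  have : lam.-integrable J (EFin \o D).
    apply/integrableP; split.
      by apply/measurable_EFinP; exact: measurable_D.
    under eq_integral do rewrite /= ger0_norm ?(slope_ge0 br)//.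
    by rewrite integral_slopeE// ltry.
  by rewrite hEF; move/(integrable_mkcond _ mJ).
pose n := density_measure h0 ih.
have mpsi : measurable_fun (setT : set (measurableTypeR R)) (psi : _ -> measurableTypeR R).
  exact: measurable_branch_inv.
pose m : {measure set (measurableTypeR R) -> \bar R} :=
  pushforward n (psi : measurableTypeR R -> measurableTypeR R).
have mE A : measurable A -> m mpsi A = mrestr lam mK A.
  move=> mA.
  pose cov (k : nat) : set (measurableTypeR R) := `]- k%:R, k%:R]%classic.
  apply: (@measure_unique _ R (measurableTypeR R) (@ocitv R) cov
    _ _ _ _ (m mpsi) (mrestr lam mK)) => //.
  - exact: ocitvI.
  - by move=> k; exists (- k%:R, k%:R).
  - apply/seteqP; split => // x _; exists (Num.Def.archi_bound `|x|) => //=.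
    have := archi_boundP (normr_ge0 x); rewrite /cov /= in_itv/=.
    rewrite ltr_norml => /andP[-> /ltW]//.
  - move=> _ [[a b]] _ <-.
    transitivity (lam (`]a, b] `&` K)); last by [].
    rewrite setI_left_half.
    transitivity (\int[lam]_(x in psi @^-1` `]a, b]) (h x)%:E)%E; first by [].
    have -> : (\int[lam]_(x in psi @^-1` `]a, b]) (h x)%:E =
        \int[lam]_(x in psi @^-1` `]a, b] `&` J) (D x)%:E)%E.
      rewrite integral_mkcondr; apply: eq_integral => x _.
      by rewrite /h !patchE; case: ifP.
    rewrite branch_inv_preimage; set c := Num.max _ _; set e := Num.min b 0.
    have c0 : c <= 0 by rewrite /c ge_max ge_min lexx orbT/=; lra.
    have e0 : e <= 0 by rewrite /e ge_min lexx orbT.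
    have [ce|ec] := leP c e.
      rewrite integral_slopeE; last exact: (branch_nondecreasing br).
      rewrite !(branchK br)// lebesgue_measure_itv/= lte_fin; move: ce; rewrite le_eqVlt.
      by case/predU1P => [->|->]; rewrite ?ltxx ?subrr// EFinB.
    rewrite set_itv_ge; last first.
      by rewrite bnd_simp -leNgt; apply: (branch_nondecreasing br); exact: ltW.
    by rewrite integral_set0 set_itv_ge ?measure0// bnd_simp -leNgt ltW.
  - move=> k; have : n (psi @^-1` cov k) \is a fin_num.
      apply: fin_num_measure; rewrite -[X in measurable X]setTI.
      by apply: (mpsi measurableT); exact: measurable_itv.
    by rewrite ge0_fin_numE.
transitivity (\int[m mpsi]_(y in K) g y)%E; last first.
  apply: eq_measure_integral => A mA AK.
  by rewrite mE// /mrestr setIidl.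
rewrite ge0_integral_pushforward//; last exact: measurable_funTS.
have mpK : measurable (psi @^-1` K).
  by rewrite -[X in measurable X]setTI; apply: (mpsi measurableT).
rewrite ge0_integral_density//; last 2 first.
- by apply: (measurableT_comp mg); exact: measurable_branch_inv.
- by move=> x; exact: g0.
rewrite integral_mkcond [RHS]integral_mkcond; apply: eq_integral => x _.
rewrite !patchE /h; case: ifPn => xJ; last by case: ifP => //; rewrite patchE (negbTE xJ) mule0.
have -> : x \in psi @^-1` K.
  rewrite inE; move: xJ; rewrite inE /J /K /= !in_itv/= => /andP[x1 x2].
  by rewrite (branch_inv_le0 br) andbT lt_branch_inv ?branchN1//; lra.
by rewrite patchE xJ.
Qed.

(** Extension by zero; this form serves integrands whose sign and measurability are checked on [K]
    only. *)
Lemma ge0_integral_branch_inv_left (g : R -> \bar R) :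
  measurable_fun K g -> (forall y : R, (-1 < y <= 0)%R -> 0 <= g y)%E ->
  (\int[lam]_(x in J) (g (psi x) * (D x)%:E) = \int[lam]_(y in K) g y)%E.
Proof.
move=> mg g0; have mK : measurable K by exact: measurable_itv.
transitivity (\int[lam]_(x in J) ((g \_ K) (psi x) * (D x)%:E))%E.
  apply: eq_integral => x; rewrite inE /J/= in_itv/= => /andP[x1 x2].
  rewrite patchE ifT// inE /K/= in_itv/= (branch_inv_le0 br) andbT.
  by rewrite lt_branch_inv ?branchN1//; lra.
rewrite ge0_integral_branch_inv.
- rewrite [RHS]integral_mkcond [LHS]integral_mkcond; apply: eq_integral => y _.
  by rewrite !patchE; case: ifP => // ->.
- exact/(measurable_restrictT _ mK).
- by move=> y; rewrite patchE; case: ifPn => //; rewrite inE /K/= in_itv/=; exact: g0.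
Qed.

End branch.

(** * Controls and their image under one step of the transfer operator *)

(** Equivalently, [u + f] and [u - f] are nonincreasing. Since only decreases of [u] count, a bound
    on [u s] leaves the variation to the left of [s] free. *)
Definition controls (R : realType) (u f : R -> R) : Prop :=
  forall x y, x <= y -> `|f x - f y| <= u x - u y.

Section controls.
Context (R : realType) (u f : R -> R).
Hypothesis uf : controls u f.

Lemma controls_nonincreasing : {homo u : x y /~ x <= y}.
Proof. by move=> y x xy; rewrite -subr_ge0; exact: le_trans (uf xy). Qed.

Lemma controls_le x y : x <= y -> f x <= f y + (u x - u y).
Proof. by move=> /uf; rewrite ler_norml => /andP[_]; lra. Qed.

Lemma controls_ge x y : x <= y -> f y <= f x + (u x - u y).
Proof. by move=> /uf; rewrite ler_norml => /andP[+ _]; lra. Qed.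

Lemma measurable_control A : measurable A -> measurable_fun A u.
Proof. by move=> mA; apply: nonincreasing_measurable => // x y; exact: controls_nonincreasing. Qed.

Lemma measurable_controlled A : measurable A -> measurable_fun A f.
Proof.
move=> mA; rewrite (_ : f = (u \+ f) \- u); last by apply/funext => x /=; ring.
apply: measurable_funB; last exact: measurable_control.
apply: nonincreasing_measurable => // x y xy /=.
by have := controls_ge xy; lra.
Qed.

End controls.

Section lasota_yorke.
Context (R : realType) (sigma psi D : R -> R).
Hypothesis br : cusp_branch sigma psi D.
Notation lam := (@lebesgue_measure R).
Let J : set (measurableTypeR R) := `]-1, 1]%classic.
Let mJ : measurable J. Proof. exact: measurable_itv. Qed.

Definition transfer (f : R -> R) x := D x * (f (psi x) + f (- psi x)).

(** Any nonnegative decreasing weight would do, because the branch moves points to the right; the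
    linear one makes the gain at [y] exactly [sigma y - y]. *)
Definition cost (u : R -> R) : \bar R := (\int[lam]_(x in J) ((1 - x) * u x)%:E)%E.

(** Markov's inequality on a subinterval. A negative [c] is allowed, so that an oscillation can be
    subtracted from a value of [f] without looking at the sign of the difference. *)
Lemma mean_bound (f : R -> R) a b c M : -1 <= a -> a <= b -> b <= 1 ->
  measurable_fun J f -> (forall x, 0 <= f x) ->
  (\int[lam]_(x in J) (f x)%:E <= M%:E)%E ->
  (forall z, a < z <= b -> c <= f z) -> c * (b - a) <= M.
Proof.
move=> a1 ab b1 mf f0 fM cf.
pose I : set (measurableTypeR R) := `]a, b]%classic.
have mI : measurable I by exact: measurable_itv.
have IJ : I `<=` J.
  by move=> z /=; rewrite /I /J/= !in_itv/= => /andP[]; lra.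
have [c0|c0] := leP c 0.
  apply: (@le_trans _ _ 0); first by rewrite mulr_le0_ge0 ?subr_ge0.
  by rewrite -lee_fin; apply: le_trans fM; apply: integral_ge0 => x _; rewrite lee_fin.
have lI : lam I = (b - a)%:E.
  rewrite lebesgue_measure_itv/= lte_fin; move: ab; rewrite le_eqVlt.
  by case/predU1P => [->|->]; rewrite ?ltxx ?subrr// EFinB.
rewrite -lee_fin; apply: le_trans fM.
rewrite EFinM -lI -(integral_cst lam mI).
apply: (@le_trans _ _ (\int[lam]_(x in I) (f x)%:E)%E).
  apply: ge0_le_integral => //.
  - by move=> x _; rewrite lee_fin ltW.
  - by apply/measurable_EFinP; exact: measurable_funS mf.
apply: ge0_subset_integral => //.
  exact/measurable_EFinP.
by move=> x _; rewrite lee_fin.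
Qed.

Section step.
Variables (f u : R -> R) (M q eps : R).
Hypotheses (f0 : forall x, 0 <= f x) (uf : controls u f)
  (fM : (\int[lam]_(x in J) (f x)%:E <= M%:E)%E)
  (q1 : -1 < q) (q2 : q < 0) (eps0 : 0 <= eps) (Dq : forall x, q < psi x -> D x <= eps).

Let D0 x := Num.min (D x) eps.
Let D1 x := Num.max (D x - eps) 0.
Let A := M / - q.

(* At level [eps] the slope splits as [D0 + D1]. The part [D1] lives where [psi x <= q],
   and there [f] is bounded by the variation of [u] plus its mean over [q, 0] or
   [0, -q], which is at most [A]; this is what makes [2 * A * D1] sufficient. *)
Definition control_step x :=
  D x * (u (psi x) - u (- psi x)) + 2 * A * D1 x + 2 * f 0 * D0 x.

Let D0_ge0 x : 0 <= D0 x.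
Proof. by rewrite /D0 le_min (slope_ge0 br). Qed.

Let D1_ge0 x : 0 <= D1 x.
Proof. by rewrite /D1 le_max lexx orbT. Qed.

Let mean_left y : y <= q -> f y - (u y - u 0) <= A.
Proof.
move=> yq; rewrite /A ler_pdivlMr ?oppr_gt0//; move: q1 q2 => ? ?.
rewrite -[- q]sub0r; apply: (@mean_bound f) => //; try lra.
  exact: (measurable_controlled uf mJ).
move=> z /andP[qz z0]; have yz : y <= z by lra.
have := controls_le uf yz; have := controls_nonincreasing uf z0; lra.
Qed.

Let mean_right y : - q <= y -> f y - (u 0 - u y) <= A.
Proof.
move=> yq; rewrite /A ler_pdivlMr ?oppr_gt0//; move: q1 q2 => ? ?.
rewrite -[- q]subr0; apply: (@mean_bound f) => //; try lra.
  exact: (measurable_controlled uf mJ).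
move=> z /andP[z0 qz]; have yz : z <= y by lra.
have := controls_ge uf yz; have := controls_nonincreasing uf (ltW z0); lra.
Qed.

Let splitD x : D x = D0 x + D1 x.
Proof.
rewrite /D0 /D1; case: (leP (D x) eps) => h.
  by rewrite max_r ?subr_le0// addr0.
by rewrite max_l ?subr_ge0 ?ltW// addrC subrK.
Qed.

Let D0_nd x y : x <= y -> D0 y <= D0 x.
Proof.
move=> xy; rewrite /D0 le_min !ge_min lexx orbT andbT.
by rewrite (slope_nd br xy).
Qed.

Let D1_nd x y : x <= y -> D1 y <= D1 x.
Proof.
move=> xy; rewrite /D1 ge_max !le_max lexx orbT andbT.
by rewrite lerD2r (slope_nd br xy).
Qed.

Let D1_eq0 x : q < psi x -> D1 x = 0.
Proof. by move=> /Dq h; rewrite /D1 max_r// subr_le0. Qed.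

Let mono0 x x' b b' : x <= x' -> 0 <= b' -> b' <= b -> D0 x' * b' <= D0 x * b.
Proof. by move=> xx' b0 bb; apply: ler_pM => //; exact: D0_nd. Qed.

Let mono1 x x' b b' : x <= x' -> b' <= b ->
  (psi x <= q -> 0 <= b) -> (psi x' <= q -> 0 <= b') -> D1 x' * b' <= D1 x * b.
Proof.
move=> xx' bb hb hb'; have [h'|h'] := leP (psi x') q.
  by apply: ler_pM => //; [exact: hb'|exact: D1_nd].
rewrite (D1_eq0 h') mul0r; have [h|h] := leP (psi x) q.
  by rewrite mulr_ge0// hb.
by rewrite (D1_eq0 h) mul0r.
Qed.

(** For each sign [s], [control_step + s * transfer f] is a sum of four products of a slope part,
    [D0] or [D1], with a bracket attached to [psi x] or [- psi x]. All factors are nonincreasing in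
    [x], so it is enough that each bracket be nonnegative where its slope part does not vanish:
    [f 0] serves for [D0], the mean [A] for [D1]. *)
Lemma controls_step : controls control_step (transfer f).
Proof.
have key s x x' : s ^+ 2 = 1 -> x <= x' ->
    control_step x' + s * transfer f x' <= control_step x + s * transfer f x.
  move=> s2 xx'.
  have s1 v : 0 <= v -> `|s * v| = v.
    move=> v0; rewrite normrM (ger0_norm v0).
    have /eqP : `|s| ^+ 2 = 1 by rewrite -normrX s2 normr1.
    by rewrite sqrf_eq1 => /orP[/eqP->|/eqP h]; [rewrite mul1r|have := normr_ge0 s; rewrite h; lra].
  have fs v : - f v <= s * f v <= f v.
    by rewrite -ler_norml s1.
  have fss v w : v <= w -> - (u v - u w) <= s * (f w - f v) <= u v - u w.
    move=> /uf; rewrite -ler_norml distrC normrM; apply: le_trans.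
    by rewrite -[leRHS]mul1r ler_wpM2r// -(s1 1)// mulr1.
  pose y := psi x; pose y' := psi x'.
  have yy' : y <= y' by exact: (branch_inv_nd br).
  have y0 : y <= 0 by exact: (branch_inv_le0 br).
  have y'0 : y' <= 0 by exact: (branch_inv_le0 br).
  have nyy' : - y' <= - y by lra.
  have nu := controls_nonincreasing uf.
  have /andP[H1 H1'] := fss _ _ yy'; have /andP[H2 H2'] := fss _ _ nyy'.
  have E1 : D0 x' * (u y' - u 0 + f 0 + s * f y') <= D0 x * (u y - u 0 + f 0 + s * f y).
    apply: mono0 => //; last lra.
    have := controls_le uf y'0; have := fs y'; case/andP; lra.
  have E2 : D0 x' * (u 0 - u (- y') + f 0 + s * f (- y')) <=
      D0 x * (u 0 - u (- y) + f 0 + s * f (- y)).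
    apply: mono0 => //; last lra.
    have h : 0 <= - y' by rewrite oppr_ge0.
    have := controls_ge uf h; have := fs (- y'); case/andP; lra.
  have E3 : D1 x' * (u y' - u 0 + A + s * f y') <= D1 x * (u y - u 0 + A + s * f y).
    apply: mono1 => //; [lra| |] => /mean_left.
      by case/andP: (fs y); lra.
    by case/andP: (fs y'); lra.
  have E4 : D1 x' * (u 0 - u (- y') + A + s * f (- y')) <= D1 x * (u 0 - u (- y) + A + s * f (- y)).
    apply: mono1 => //; [lra| |]; rewrite -lerN2 => /mean_right.
      by case/andP: (fs (- y)); lra.
    by case/andP: (fs (- y')); lra.
  rewrite /control_step /transfer !splitD -/y -/y'; lra.
move=> x x' xx'.
have := key 1 x x' (expr1n _ _) xx'; have := key (-1) x x' _ xx'.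
by rewrite sqrrN expr1n ler_norml => /(_ erefl); lra.
Qed.

Lemma control_step_eq0 x : 1 <= x -> control_step x = 0.
Proof.
move=> x1; rewrite /control_step /D0 /D1 (slope_1 br x1) min_l// max_r; first by ring.
by rewrite sub0r oppr_le0.
Qed.

End step.
End lasota_yorke.

(** * Duality between the transfer operator and preimages *)

Section transfer.
Context (R : realType) (sigma psi D : R -> R).
Hypothesis br : cusp_branch sigma psi D.
Notation lam := (@lebesgue_measure R).
Let J : set (measurableTypeR R) := `]-1, 1]%classic.
Let K : set (measurableTypeR R) := `]-1, 0]%classic.
Notation transfer := (transfer psi D).

Lemma ge0_integralN (A : set (measurableTypeR R)) (f : R -> \bar R) :
  measurable A -> measurable_fun setT f -> (forall x, 0 <= f x)%E ->
  (\int[lam]_(x in -%R @^-1` A) f x = \int[lam]_(x in A) f (- x)%R)%E.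
Proof.
move=> mA mf f0; pose B : set (measurableTypeR R) := -%R @^-1` A.
have mN : measurable_fun (setT : set (measurableTypeR R))
    (-%R : measurableTypeR R -> measurableTypeR R).
  exact: oppr_measurable.
have mB : measurable B by rewrite -[X in measurable X]setTI; exact: mN.
have AE : A = -%R @^-1` B by apply/seteqP; split => x; rewrite /B/= opprK.
rewrite {2}AE -(@ge0_integral_pushforward _ _ (measurableTypeR R)
  (measurableTypeR R) R -%R mN lam B f)//; last exact: measurable_funTS.
by apply: eq_measure_integral => X mX _; rewrite -[LHS](lebesgue_measureN mX).
Qed.

Definition preim_left (B : set (measurableTypeR R)) : set (measurableTypeR R) :=
  [set y | -1 <= y <= 0 /\ B (sigma y)].

(** By the symmetry of the map the right preimage is the mirror image of the left one, so the single
    branch [sigma] describes both. *)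
Definition preim_right (B : set (measurableTypeR R)) : set (measurableTypeR R) :=
  -%R @^-1` preim_left B.

Lemma measurable_preim_left B : measurable B -> measurable (preim_left B).
Proof.
move=> mB; rewrite (_ : preim_left B = `[-1, 0]%classic `&` sigma @^-1` B).
  by apply: (measurable_branch br) => //; exact: measurable_itv.
by apply/seteqP; split => y /=; rewrite in_itv.
Qed.

Lemma measurable_preim_right B : measurable B -> measurable (preim_right B).
Proof.
move=> /measurable_preim_left mB; rewrite /preim_right -[X in measurable X]setTI.
exact: oppr_measurable.
Qed.

Lemma preim_leftE (B : set (measurableTypeR R)) : B `<=` J ->
  preim_left B = K `&` sigma @^-1` B.
Proof.
move=> BJ; apply/seteqP; split => y /=; rewrite /K/= in_itv/=.
  move=> [/andP[y1 y0] By]; split=> //; rewrite y0 andbT lt_neqAle y1 andbT.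
  apply/eqP => y1E; have := BJ _ By; rewrite -y1E (branchN1 br) /J/= in_itv/=; lra.
by move=> [/andP[/ltW h1 h2] By]; split => //; apply/andP.
Qed.

Lemma ge0_integral_preim_left (g : R -> \bar R) (B : set (measurableTypeR R)) :
  measurable B -> B `<=` J -> measurable_fun setT g -> (forall x, 0 <= g x)%E ->
  (\int[lam]_(y in preim_left B) g y = \int[lam]_(x in B) (g (psi x) * (D x)%:E))%E.
Proof.
move=> mB BJ mg g0; rewrite (preim_leftE BJ) integral_mkcondr.
rewrite -(ge0_integral_branch_inv_left br (g := g \_ (sigma @^-1` B))).
- have {2}-> : B = J `&` B by rewrite setIidr.
  rewrite [RHS]integral_mkcondr; apply: eq_integral => x; rewrite inE => xJ.
  rewrite !patchE; have x1 : x <= 1 by move: xJ; rewrite /J/= in_itv/= => /andP[].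
  have -> : (psi x \in sigma @^-1` B) = (x \in B).
    by apply/idP/idP; rewrite !inE/= (branch_invK br).
  by case: ifP => _ //; rewrite mul0e.
- apply/measurable_restrict => //; last exact: measurable_funTS.
  by rewrite -[X in measurable X]setTI; apply: (measurable_branch br).
- by move=> y _; rewrite patchE; case: ifP.
Qed.

Lemma ge0_integral_preim_right (g : R -> \bar R) (B : set (measurableTypeR R)) :
  measurable B -> B `<=` J -> measurable_fun setT g -> (forall x, 0 <= g x)%E ->
  (\int[lam]_(y in preim_right B) g y = \int[lam]_(x in B) (g (- psi x)%R * (D x)%:E))%E.
Proof.
move=> mB BJ mg g0; rewrite ge0_integralN//; last exact: measurable_preim_left.
rewrite ge0_integral_preim_left//.
by apply: (measurableT_comp mg); exact: oppr_measurable.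
Qed.

Lemma ge0_integral_transfer (f : R -> R) (B : set (measurableTypeR R)) :
  measurable B -> B `<=` J -> measurable_fun setT f -> (forall x, 0 <= f x) ->
  (\int[lam]_(x in B) (transfer f x)%:E =
   \int[lam]_(x in preim_left B) (f x)%:E +
   \int[lam]_(x in preim_right B) (f x)%:E)%E.
Proof.
move=> mB BJ mf f0.
have mf' : measurable_fun setT (EFin \o f) by exact/measurable_EFinP.
have mpsi : measurable_fun B psi by exact: (measurable_branch_inv br).
have mD : measurable_fun B D by exact: (measurable_D br).
rewrite (ge0_integral_preim_left mB BJ mf')// (ge0_integral_preim_right mB BJ mf')//.
rewrite -ge0_integralD//=.
- by apply: eq_integral => x _; rewrite -!EFinM -EFinD /transfer mulrC mulrDl.
- by move=> x _; rewrite -EFinM lee_fin mulr_ge0 ?(slope_ge0 br).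
- apply/measurable_EFinP; apply: measurable_funM => //.
  exact: (measurableT_comp mf).
- by move=> x _; rewrite -EFinM lee_fin mulr_ge0 ?(slope_ge0 br).
- apply/measurable_EFinP; apply: measurable_funM => //.
  apply: (measurableT_comp mf); apply: (measurableT_comp _ mpsi).
  exact: oppr_measurable.
Qed.

Lemma lebesgue_preim_left (B : set (measurableTypeR R)) : measurable B -> B `<=` J ->
  lam (preim_left B) = (\int[lam]_(x in B) (D x)%:E)%E.
Proof.
move=> mB BJ; have mL := measurable_preim_left mB.
transitivity (\int[lam]_(y in preim_left B) (cst 1 y))%E.
  by rewrite integral_cst// mul1e.
by rewrite ge0_integral_preim_left//; apply: eq_integral => x _; rewrite mul1e.
Qed.

Lemma lebesgue_preim_right (B : set (measurableTypeR R)) : measurable B -> B `<=` J ->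
  lam (preim_right B) = (\int[lam]_(x in B) (D x)%:E)%E.
Proof.
move=> mB BJ; rewrite -lebesgue_preim_left//.
by rewrite -(lebesgue_measureN (measurable_preim_left mB)).
Qed.

End transfer.

(** * The weighted cost under one step *)

Section cost.
Context (R : realType) (sigma psi D : R -> R).
Hypothesis br : cusp_branch sigma psi D.
Notation lam := (@lebesgue_measure R).
Let J : set (measurableTypeR R) := `]-1, 1]%classic.
Let K : set (measurableTypeR R) := `]-1, 0]%classic.
Let mJ : measurable J. Proof. exact: measurable_itv. Qed.
Let mK : measurable K. Proof. exact: measurable_itv. Qed.

Lemma lebesgue_itvoc (a b : R) : a <= b -> lam (`]a, b]%classic) = (b - a)%:E.
Proof.
rewrite lebesgue_measure_itv/= lte_fin le_eqVlt.
by case/predU1P => [->|->]; rewrite ?ltxx ?subrr// EFinB.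
Qed.

Lemma branch_expanding x y : x <= y -> y <= 0 -> y - x <= sigma y - sigma x.
Proof.
move=> xy y0; have x0 := le_trans xy y0.
have sxy := branch_nondecreasing br xy.
have := chord_le br sxy; rewrite !(branchK br)// => /le_trans; apply.
by rewrite ler_piMl ?subr_ge0// (slope_le1 br).
Qed.

Lemma branch_gt y : -1 < y -> y <= 0 -> y < sigma y.
Proof.
move=> y1 y0; rewrite -{1}(branchK br y0); apply: (branch_inv_lt br).
rewrite ltNge; apply/negP => h; move: y1.
by rewrite -(branchK br y0) (branch_inv_N1 br h) ltNge h.
Qed.

Lemma control_ge0 (f u : R -> R) : controls u f -> (forall x, 1 <= x -> u x = 0) ->
  forall x, 0 <= u x.
Proof.
move=> uf u1 x; rewrite -(u1 (Num.max x 1)) ?le_max ?lexx ?orbT//.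
by apply: (controls_nonincreasing uf); rewrite le_max lexx.
Qed.

(* Pulling back along the branch turns the weight [1 - x] into [1 - sigma y], and the
   gain comes from [sigma r - r <= sigma y - y] on [r, s]. *)
Lemma cost_step (f u : R -> R) (M q eps r s : R) :
  (forall x, 0 <= f x) -> controls u f -> (forall x, 1 <= x -> u x = 0) ->
  0 <= M -> q < 0 -> 0 <= eps -> -1 < r -> r < s -> s < 0 ->
  (cost (control_step psi D f u M q eps) + ((sigma r - r) * (s - r) * u s)%:E <=
   cost u + (8 * (M / - q) + 8 * eps * f 0)%:E)%E.
Proof.
move=> f0 uf u1 M0 q0 eps0 r1 rs s0.
have u0 := control_ge0 uf u1.
have und := controls_nonincreasing uf.
have A0 : 0 <= M / - q by rewrite divr_ge0 // oppr_ge0 ltW.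
have r0 : r <= 0 by lra.
have g0 : 0 < sigma r - r by rewrite subr_gt0 branch_gt.
set g := sigma r - r in g0 *.
(* Bound for the weight times the last two terms of [control_step], from [1 - x <= 2], [D1 <= 1] and
   [D0 <= eps]. Integration over [J], of length 2, doubles it. *)
pose c := 4 * (M / - q) + 4 * eps * f 0.
have e0 : 0 <= eps * f 0 by rewrite mulr_ge0.
have c0 : 0 <= c by rewrite /c; lra.
pose G y := (1 - sigma y) * (u y - u (- y)).
have mu_ (A : set R) : measurable A -> measurable_fun A u.
  by move=> mA; exact: (measurable_control uf mA).
have muN (A : set R) : measurable A -> measurable_fun A (fun x : R => u (- x)).
  move=> mA; apply: (measurableT_comp (mu_ _ measurableT)).
  by apply: measurable_funTS; exact: oppr_measurable.
have mG (A : set R) : measurable A -> measurable_fun A G.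
  move=> mA; apply: measurable_funM.
    by apply: measurable_funB => //; exact: (measurable_branch br).
  by apply: measurable_funB; [exact: mu_|exact: muN].
have G0 y : -1 < y <= 0 -> 0 <= G y.
  move=> /andP[y1 y0]; rewrite mulr_ge0// subr_ge0 ?(branch_le1 br)//.
  by apply: und; lra.
have mD (A : set R) : measurable A -> measurable_fun A D.
  by move=> mA; exact: (measurable_D br mA).
have mpsi (A : set R) : measurable A -> measurable_fun A psi.
  by move=> mA; exact: (measurable_branch_inv br mA).
have mGD : measurable_fun J (fun x => (G (psi x))%:E * (D x)%:E)%E.
  apply: emeasurable_funM; apply/measurable_EFinP; last exact: mD.
  by apply: (measurableT_comp (mG _ measurableT)); exact: mpsi.
have mstep : measurable_fun J (control_step psi D f u M q eps).
  apply: measurable_funD; first apply: measurable_funD.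
  - apply: measurable_funM; first exact: mD.
    apply: measurable_funB.
      by apply: (measurableT_comp (mu_ _ measurableT)); exact: mpsi.
    by apply: (measurableT_comp (muN _ measurableT)); exact: mpsi.
  - apply: measurable_funM => //; apply: measurable_maxr => //.
    by apply: measurable_funB => //; exact: mD.
  - by apply: measurable_funM => //; apply: measurable_minr => //; exact: mD.
have psiK x : -1 < x -> x <= 1 -> -1 < psi x <= 0.
  move=> x1 x2; rewrite (branch_inv_le0 br) andbT.
  by rewrite (lt_branch_inv br) ?(branchN1 br)//; lra.
have le1 : (cost (control_step psi D f u M q eps) <=
    \int[lam]_(y in K) (G y)%:E + (2 * c)%:E)%E.
  rewrite -(ge0_integral_branch_inv_left br); last 2 first.
  - by apply/measurable_EFinP; exact: mG.
  - by move=> y /G0; rewrite lee_fin.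
  have -> : (2 * c)%:E = (\int[lam]_(x in J) (cst c%:E x))%E.
    transitivity (c%:E * lam J)%E; last by rewrite integral_cst.
    rewrite lebesgue_itvoc; last lra.
    by rewrite -EFinM; congr EFin; ring.
  rewrite -ge0_integralD//; last first.
    move=> x; rewrite /J/= in_itv/= => /andP[x1 x2].
    by rewrite mule_ge0 ?lee_fin ?(slope_ge0 br) ?G0// psiK.
  have bnd x : -1 < x -> x <= 1 ->
      [/\ 0 <= (1 - x) * control_step psi D f u M q eps x &
      (1 - x) * control_step psi D f u M q eps x <= G (psi x) * D x + c].
    move=> x1 x2; rewrite /control_step /G (branch_invK br)//.
    have D0x := slope_ge0 br x; have D1x := slope_le1 br x.
    have p0 : 0 <= 1 - x by lra.
    have /andP[_ psi0] := psiK x x1 x2.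
    have W0 : 0 <= u (psi x) - u (- psi x).
      by rewrite subr_ge0; apply: und; lra.
    set d1 := Num.max _ _; set d0 := Num.min _ _.
    have d10 : 0 <= d1 by rewrite /d1 le_max lexx orbT.
    have d11 : d1 <= 1 by rewrite /d1 ge_max ler01 andbT; lra.
    have d00 : 0 <= d0 by rewrite /d0 le_min D0x.
    have d0e : d0 <= eps by rewrite /d0 ge_min lexx orbT.
    set a := M / - q in A0 *.
    have h1 : (1 - x) * (a * d1) <= 2 * (a * 1).
      by apply: ler_pM => //; [exact: mulr_ge0|lra|exact: ler_wpM2l].
    have h2 : (1 - x) * (f 0 * d0) <= 2 * (f 0 * eps).
      by apply: ler_pM => //; [exact: mulr_ge0|lra|exact: ler_wpM2l].
    split.
      have h3 : 0 <= D x * (u (psi x) - u (- psi x)) by exact: mulr_ge0.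
      have h4 : 0 <= a * d1 by exact: mulr_ge0.
      have h5 : 0 <= f 0 * d0 by exact: mulr_ge0.
      by apply: mulr_ge0 => //; lra.
    rewrite /c -/a; lra.
  apply: ge0_le_integral => //.
  - by move=> x; rewrite /J/= in_itv/= => /andP[x1 x2]; case: (bnd x x1 x2); rewrite lee_fin.
  - apply/measurable_EFinP; apply: measurable_funM => //.
    by apply: measurable_funB.
  - by apply: emeasurable_funD.
  - move=> x; rewrite /J/= in_itv/= => /andP[x1 x2].
    by rewrite -EFinM -EFinD lee_fin; case: (bnd x x1 x2).
have le2 : (\int[lam]_(y in K) (G y)%:E + (g * (s - r) * u s)%:E <=
    cost u)%E.
  pose I : set (measurableTypeR R) := `]r, s]%classic.
  have mI : measurable I by exact: measurable_itv.
  have IK : K `&` I = I.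
    by rewrite setIidr// => x /=; rewrite /I/K/= !in_itv/= => /andP[]; lra.
  have -> : (g * (s - r) * u s)%:E = (\int[lam]_(x in K) (cst (g * u s)%:E \_ I) x)%E.
    rewrite -integral_mkcondr IK.
    transitivity ((g * u s)%:E * lam I)%E; last by rewrite integral_cst.
    rewrite lebesgue_itvoc ?(ltW rs)//.
    by rewrite -EFinM; congr EFin; ring.
  have gu0 : 0 <= g * u s by rewrite mulr_ge0// ltW.
  rewrite -ge0_integralD//; last 3 first.
  - by apply/measurable_EFinP; exact: mG.
  - by move=> y _; rewrite patchE; case: ifP => //=; rewrite lee_fin.
  - by apply/measurable_restrict => //; rewrite IK.
  apply: (@le_trans _ _ (\int[lam]_(y in K) ((1 - y) * u y)%:E)%E).
    apply: ge0_le_integral => //.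
    + move=> y Ky; rewrite adde_ge0//.
        by move: Ky; rewrite /K/= in_itv/= => /G0; rewrite lee_fin.
      by rewrite patchE; case: ifP => //=; rewrite lee_fin.
    + apply: emeasurable_funD; first by apply/measurable_EFinP; exact: mG.
      by apply/measurable_restrict => //; rewrite IK.
    + apply/measurable_EFinP; apply: measurable_funM; last exact: mu_.
      by apply: measurable_funB.
    + move=> y; rewrite /K/= in_itv/= => /andP[y1 y0].
      have sy : sigma y <= 1 by exact: (branch_le1 br).
      have sy0 : y <= sigma y by exact: (branch_ge br).
      have GE : G y <= (1 - sigma y) * u y.
        rewrite /G ler_wpM2l ?subr_ge0//; have := u0 (- y); lra.
      rewrite patchE; case: ifPn => /=; last first.
        move=> _; rewrite adde0 lee_fin; apply: le_trans GE _.
        by rewrite ler_wpM2r//; lra.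
      rewrite inE /I/= in_itv/= => /andP[ry ys].
      rewrite -EFinD lee_fin.
      have e1 : g <= sigma y - y.
        have := branch_expanding (ltW ry) y0; rewrite /g; lra.
      have e2 : g * u s <= (sigma y - y) * u y.
        by apply: ler_pM => //; [exact: ltW|exact: und].
      lra.
  apply: ge0_subset_integral => //.
  - apply/measurable_EFinP; apply: measurable_funM; last exact: mu_.
    by apply: measurable_funB.
  - by move=> x; rewrite /J/= in_itv/= => /andP[x1 x2]; rewrite lee_fin mulr_ge0 ?subr_ge0.
  - by move=> x /=; rewrite /J/K/= !in_itv/= => /andP[]; lra.
have -> : (8 * (M / - q) + 8 * eps * f 0)%:E = (2 * c)%:E.
  by congr EFin; rewrite /c; ring.
apply: le_trans (leeD2r _ le1) _.
by rewrite addeAC; exact: leeD2r.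
Qed.

End cost.

(** * Approximations of the invariant measure with a bounded control *)

Section descent.
Context (R : realType) (sigma psi D : R -> R).
Hypothesis br : cusp_branch sigma psi D.
Notation lam := (@lebesgue_measure R).
Variable mu : {measure set (measurableTypeR R) -> \bar R}.
Let J : set (measurableTypeR R) := `]-1, 1]%classic.
Let O : set (measurableTypeR R) := `]-1, 1[%classic.
Let mJ : measurable J. Proof. exact: measurable_itv. Qed.
Let mO : measurable O. Proof. exact: measurable_itv. Qed.
Hypothesis mu1 : (mu O <= 1)%E.
Hypothesis mu_inv : forall B : set (measurableTypeR R), measurable B -> B `<=` O ->
  mu B = mu (preim_left sigma B `|` preim_right sigma B).

(** The error is additive and uniform in [B]: in this form the transfer operator preserves it, and
    it can be sent to 0 while the constants of the bounds stay fixed. *)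
Definition near_density (f : R -> R) (e : R) : Prop :=
  forall B : set (measurableTypeR R), measurable B -> B `<=` `]-1, 1[%classic ->
  (\int[lam]_(x in B) (f x)%:E <= mu B + e%:E)%E /\
  (mu B <= \int[lam]_(x in B) (f x)%:E + e%:E)%E.

(** Vanishing to the right of 1 normalises the control: [u s] then bounds the oscillation of [f] on
    the whole of [s, 1]. *)
Record admissible (f u : R -> R) (e : R) : Prop := Admissible {
  adm_ge0 : forall x, 0 <= f x;
  adm_controls : controls u f;
  adm_eq0 : forall x, 1 <= x -> u x = 0;
  adm_near : near_density f e }.

(** The two preimages could only meet at 0, whose image 1 lies outside [O]. *)
Lemma preim_cap B : B `<=` O -> preim_left sigma B `&` preim_right sigma B `<=` set0.
Proof.
move=> BO y [] [/andP[_ y0] By] [/andP[_ y1] _].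
have y00 : y = 0 by move: y1 => /=; lra.
by have := BO _ By; rewrite y00 (branch0 br) /O/= in_itv/= ltxx andbF.
Qed.

Lemma preim_sub B : B `<=` O -> preim_left sigma B `|` preim_right sigma B `<=` O.
Proof.
have N1 y : B `<=` O -> preim_left sigma B y -> -1 < y /\ y < 0.
  move=> BO [/andP[y1 y0] By]; have := BO _ By; rewrite /O/= in_itv/= => /andP[s1 s2].
  split; rewrite lt_neqAle ?y1 ?y0 andbT; apply/eqP => yE.
    by move: s1; rewrite -yE (branchN1 br) ltxx.
  by move: s2; rewrite yE (branch0 br) ltxx.
move=> BO y [/(N1 _ BO)|/(N1 _ BO)] []; rewrite /O/= in_itv/=; lra.
Qed.

(** The error does not grow because the estimate for [transfer f] on [B] is the estimate for [f] on
    the full preimage of [B], which has the same [mu] measure. *)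
Lemma near_transfer (f : R -> R) (e : R) : (forall x, 0 <= f x) -> measurable_fun [set: R] f ->
  near_density f e -> near_density (transfer psi D f) e.
Proof.
move=> f0 mf nf B mB BO; rewrite mu_inv//.
have mL := measurable_preim_left br mB; have mR := measurable_preim_right br mB.
rewrite (ge0_integral_transfer br)//; last first.
  by move=> x /BO; rewrite /O/J/= !in_itv/= => /andP[-> /ltW].
rewrite -ge0_integral_setU//.
- apply: nf; [exact: measurableU|exact: preim_sub].
- by apply/measurable_EFinP; exact: measurable_funTS.
- by move=> x _; rewrite lee_fin.
- by apply/disj_setPS; exact: preim_cap.
Qed.

Lemma near_mass (f : R -> R) (e : R) : e <= 1 -> measurable_fun [set: R] f -> near_density f e ->
  (\int[lam]_(x in J) (f x)%:E <= 2%:E)%E.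
Proof.
move=> e1 mf /(_ O mO (@subset_refl _ _))[h _].
rewrite -integral_itv_bndo_bndc; last by apply/measurable_EFinP; exact: measurable_funTS.
apply: le_trans h _; rewrite (_ : 2%:E = (1 + 1)%E); last by rewrite -EFinD.
by apply: leeD => //; rewrite lee_fin.
Qed.

(** This bound depends on the approximation; it only ensures that the descent starts from a finite
    cost and does not enter the final constants. *)
Lemma cost_le (f u : R -> R) : controls u f -> (forall x, 1 <= x -> u x = 0) ->
  (cost u <= (4 * u (-1))%:E)%E.
Proof.
move=> uf u1; have u0 := control_ge0 uf u1.
have -> : (4 * u (-1))%:E = (\int[lam]_(x in J) (cst (2 * u (-1))%:E x))%E.
  transitivity ((2 * u (-1))%:E * lam J)%E; last by rewrite integral_cst.
  rewrite lebesgue_itvoc; last lra.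
  by rewrite -EFinM; congr EFin; ring.
apply: ge0_le_integral => //.
- by move=> x; rewrite /J/= in_itv/= => /andP[x1 x2]; rewrite lee_fin mulr_ge0 ?subr_ge0.
- apply/measurable_EFinP; apply: measurable_funM; last exact: (measurable_control uf).
  by apply: measurable_funB.
- move=> x; rewrite /J/= in_itv/= => /andP[x1 x2]; rewrite lee_fin.
  apply: ler_pM => //; [lra|lra|].
  by apply: (controls_nonincreasing uf); exact: ltW.
Qed.

(** The order of the choices matters: the gain [g] on [r, s] depends only on the branch and on [s],
    [eps] is taken small against it, and [q] is then available because the slope becomes arbitrarily
    small near the cusp value 1. The price [M / - q] goes into [C]. *)
Lemma lasota_yorke s : -1 < s < 0 -> exists c C : R, [/\ 0 < c, 0 <= C &
  forall f u M, (forall x, 0 <= f x) -> controls u f -> (forall x, 1 <= x -> u x = 0) ->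
    (\int[lam]_(x in J) (f x)%:E <= M%:E)%E ->
  exists u', [/\ controls u' (transfer psi D f), forall x, 1 <= x -> u' x = 0 &
    (cost u' + (c * u s)%:E <= cost u + (C * M)%:E)%E]].
Proof.
move=> /andP[s1 s0]; pose r := (s - 1) / 2.
have r1 : -1 < r by rewrite /r; lra.
have rs : r < s by rewrite /r; lra.
have r0 : r <= 0 by lra.
have g0 : 0 < (sigma r - r) * (s - r).
  by rewrite mulr_gt0 ?subr_gt0// (branch_gt br).
set g := (sigma r - r) * (s - r) in g0.
(* With [eps = g / 16] and [f 0 <= u s + M], the term [8 * eps * f 0] costs at most
   [g / 2 * (u s + M)], so that half of the gain survives. *)
have eps0 : 0 < g / 16 by lra.
have [t [/andP[t1 t2] Dt]] := slope_small br eps0.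
pose q := psi t.
have q0 : q < 0.
  rewrite lt_neqAle (branch_inv_le0 br) andbT; apply/eqP => qE; have := t2.
  by rewrite -(branch_invK br (ltW t2)) -/q qE (branch0 br) ltxx.
have q1 : -1 < q by rewrite (lt_branch_inv br) ?(branchN1 br)//; lra.
have Dq x : q < psi x -> D x <= g / 16.
  move=> qx; apply: le_trans Dt; apply: (slope_nd br).
  by rewrite leNgt; apply/negP => /ltW /(branch_inv_nd br); rewrite leNgt qx.
exists (g / 2), (8 * (- q)^-1 + g / 2); split; [by lra| |].
  have : 0 <= (- q)^-1 by rewrite invr_ge0 oppr_ge0 ltW.
  by set i := (- q)^-1; lra.
move=> f u M f0 uf u1 fM.
have M0 : 0 <= M.
  by rewrite -lee_fin; apply: le_trans fM; apply: integral_ge0 => x _; rewrite lee_fin.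
exists (control_step psi D f u M q (g / 16)); split.
- exact: (controls_step br f0 uf fM q1 q0 (ltW eps0) Dq).
- by move=> x x1; apply: (control_step_eq0 br) => //; exact: ltW.
have fu : f 0 <= u s + M.
  suff : (f 0 - u s) * (1 - 0) <= M by lra.
  apply: (@mean_bound R f 0 1 _ M) => //; try lra.
    exact: (measurable_controlled uf mJ).
  move=> z /andP[z0 z1].
  have := controls_le uf (ltW z0); have := controls_nonincreasing uf (ltW s0).
  have := control_ge0 uf u1 z; lra.
have := cost_step br f0 uf u1 M0 q0 (ltW eps0) r1 rs s0; rewrite -/g.
move: (cost (control_step psi D f u M q (g / 16))) (cost u) => k1 k0 h.
have us0 : (g / 2 * u s)%:E \is a fin_num by [].
rewrite -(leeD2rE _ _ us0) -!addeA -[((g / 2 * u s)%:E + _)%E]EFinD -[((_ * M)%:E + _)%E]EFinD.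
rewrite (_ : g / 2 * u s + g / 2 * u s = g * u s); last by field.
apply: le_trans h _; apply: leeD => //; rewrite lee_fin.
have : 8 * (g / 16) * f 0 <= 8 * (g / 16) * (u s + M).
  by apply: ler_wpM2l => //; lra.
set i := (- q)^-1; lra.
Qed.

(* As long as [u s] is too large, one application of the transfer operator lowers the
   nonnegative cost by 1. *)
Lemma descent s : -1 < s < 0 -> exists C0 : R, forall f u e, e <= 1 ->
  admissible f u e -> exists f' u', admissible f' u' e /\ u' s <= C0.
Proof.
move=> /lasota_yorke[c [C [c0 C1 LY]]].
(* The masses are at most 2, so one step adds at most [2 * C] to the cost; above this threshold the
   gain [c * u s] exceeds that by 1. *)
exists ((2 * C + 1) / c) => f u e e1 adm; apply: contrapT => nex.
have big f' u' : admissible f' u' e -> 2 * C + 1 < c * u' s.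
  move=> adm'; rewrite [c * _]mulrC -ltr_pdivrMr// ltNge; apply/negP => h.
  by apply: nex; exists f', u'; split.
have iter n : exists f' u', admissible f' u' e /\ (cost u' + n%:R%:E <= cost u)%E.
  elim: n => [|n [f' [u' [adm' h]]]]; first by exists f, u; split => //; rewrite adde0.
  have [f0 uf u1 nf] := adm'.
  have mf : measurable_fun [set: R] f' by exact: (measurable_controlled uf).
  have [u'' [uf'' u1'' h'']] := LY f' u' 2 f0 uf u1 (near_mass e1 mf nf).
  exists (transfer psi D f'), u''; split.
    split => //; last exact: near_transfer.
    by move=> x; rewrite /transfer mulr_ge0 ?(slope_ge0 br)// addr_ge0.
  have b := big _ _ adm'.
  have fin : (2 * C)%:E \is a fin_num by [].
  apply: le_trans h; rewrite -(leeD2rE _ _ fin).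
  move: (cost u'') (cost u') h'' => k1 k0 h''.
  rewrite [leRHS]addeAC (mulrC 2 C); apply: le_trans (leeD2r n%:R%:E h'').
  rewrite -!addeA -[(n.+1%:R%:E + _)%E]EFinD -[((c * _)%:E + _)%E]EFinD.
  by apply: leeD => //; rewrite lee_fin -natr1; lra.
have [_ uf u1 _] := adm.
have [n hn] : exists n : nat, 4 * u (-1) < n%:R.
  exists (Num.Def.archi_bound (4 * u (-1))); apply: archi_boundP.
  by rewrite mulr_ge0// (control_ge0 uf u1).
have [f' [u' [[_ uf' u1' _] h]]] := iter n.
have := le_trans h (cost_le uf u1).
have c1 : (0 <= cost u')%E.
  apply: integral_ge0 => x; rewrite /= in_itv/= => /andP[x1 x2].
  by rewrite lee_fin mulr_ge0 ?subr_ge0// (control_ge0 uf' u1').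
move=> h2; have : (n%:R%:E <= (4 * u (-1))%:E)%E.
  by apply: le_trans h2; rewrite leeDr.
by rewrite lee_fin leNgt hn.
Qed.

End descent.

(** * Upper bound away from -1; images of intervals carrying a lower bound *)

Section bounds.
Context (R : realType) (sigma psi D : R -> R).
Hypothesis br : cusp_branch sigma psi D.
Notation lam := (@lebesgue_measure R).
Variable mu : {measure set (measurableTypeR R) -> \bar R}.
Let J : set (measurableTypeR R) := `]-1, 1]%classic.
Let O : set (measurableTypeR R) := `]-1, 1[%classic.
Let mJ : measurable J. Proof. exact: measurable_itv. Qed.
Hypothesis mu1 : (mu O = 1)%E.
Hypothesis mu_inv : forall B : set (measurableTypeR R), measurable B -> B `<=` O ->
  mu B = mu (preim_left sigma B `|` preim_right sigma B).
Hypothesis mu_approx : forall e, 0 < e -> exists f u, admissible mu f u e.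

Let mu_descent s : -1 < s < 0 -> exists C0 : R, 0 <= C0 /\ forall e, 0 < e -> e <= 1 ->
  exists f u, admissible mu f u e /\ u s <= C0.
Proof.
move=> s10; have mu_le1 : (mu O <= 1)%E by rewrite mu1.
have [C0 H] := descent br mu_le1 mu_inv s10.
exists (Num.max C0 0); split; first by rewrite le_max lexx orbT.
move=> e e0 e1; have [f [u a]] := mu_approx e0.
have [f' [u' [a' h]]] := H f u e e1 a.
by exists f', u'; split => //; rewrite le_max h.
Qed.

Let mass_le f u e : e <= 1 -> admissible mu f u e ->
  (\int[lam]_(x in J) (f x)%:E <= 2%:E)%E.
Proof.
move=> e1 [f0 uf u1 nf]; have mu_le1 : (mu O <= 1)%E by rewrite mu1.
exact: (near_mass mu_le1 e1 (measurable_controlled uf measurableT) nf).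
Qed.

Let controls_osc f u e s x z : admissible mu f u e -> s <= x -> s <= z ->
  f x <= f z + u s.
Proof.
move=> [f0 uf u1 _] sx sz; have u0 := control_ge0 uf u1.
have und := controls_nonincreasing uf.
have [xz|/ltW zx] := leP x z.
  by have := controls_le uf xz; have := und _ _ sx; have := u0 z; lra.
by have := controls_ge uf zx; have := und _ _ sz; have := u0 x; lra.
Qed.

(** The bound on [u s] provided by the descent does not depend on the error [e], which can therefore
    tend to 0. *)
Lemma mu_upper s : -1 < s < 0 -> exists C : R, 0 <= C /\
  forall B : set (measurableTypeR R), measurable B -> B `<=` `]s, 1[%classic ->
    (mu B <= C%:E * lam B)%E.
Proof.
move=> s10; have [C0 [C00 H]] := mu_descent s10; case/andP: (s10) => s1 s0.
(* On []s, 1]], of length more than 1, [f] has mass at most 2 and oscillates by at most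
   [u s <= C0]. *)
exists (C0 + 2); split; first lra.
move=> B mB Bs.
have BO : B `<=` O.
  by move=> x /Bs; rewrite /O/= !in_itv/= => /andP[]; lra.
apply/lee_addgt0Pr => e e0; pose e' := Num.min e 1.
have e'0 : 0 < e' by rewrite lt_min e0 ltr01.
have e'1 : e' <= 1 by rewrite ge_min lexx orbT.
have [f [u [a us]]] := H e' e'0 e'1.
have [f0 uf u1 nf] := a.
have [_ h] := nf B mB BO; apply: le_trans h _; apply: leeD; last first.
  by rewrite lee_fin ge_min lexx.
have mf : measurable_fun J f by exact: (measurable_controlled uf).
have f2 := mass_le e'1 a.
have fle (x : R) : s < x -> x <= 1 -> f x <= C0 + 2.
  move=> sx x1; have : (f x - C0) * (1 - s) <= 2.
    apply: (@mean_bound R f s 1 (f x - C0) 2) => //; try lra.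
    by move=> z /andP[sz z1]; have := controls_osc a (ltW sx) (ltW sz); lra.
  have [|h] := leP (f x - C0) 0; first by lra.
  by nra.
rewrite -(integral_cst lam mB); apply: ge0_le_integral => //.
- by move=> x _; rewrite lee_fin.
- by apply/measurable_EFinP; exact: (measurable_controlled uf).
- by move=> x /Bs; rewrite /= in_itv/= lee_fin => /andP[sx /ltW x1]; exact: fle.
Qed.

(** The constant is existential because it gets worse with each image, while only finitely many
    images are taken. *)
Definition good p q := exists c : R, 0 < c /\
  forall B : set (measurableTypeR R), measurable B -> B `<=` `]p, q[%classic ->
    (c%:E * lam B <= mu B)%E.

Lemma slope_gt0 x : x < 1 -> 0 < D x.
Proof.
move=> x1; have := chord_le br (ltW x1); rewrite (branch_inv_1 br (lexx _)) sub0r.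
have : psi x < 0.
  rewrite lt_neqAle (branch_inv_le0 br) andbT; apply/eqP => h; have := x1.
  by rewrite -(branch_invK br (ltW x1)) h (branch0 br) ltxx.
move=> h1 h2; rewrite -(@pmulr_lgt0 _ (1 - x)); lra.
Qed.

Lemma slope_lt1 x : -1 < x -> D x < 1.
Proof.
move=> x1; have := chord_ge br (ltW x1); rewrite (branch_inv_N1 br (lexx _)).
by have := branch_inv_lt br x1; nra.
Qed.

Lemma integral_D_ge (B : set (measurableTypeR R)) y : measurable B ->
  (forall x, B x -> x <= y) -> ((D y)%:E * lam B <= \int[lam]_(x in B) (D x)%:E)%E.
Proof.
move=> mB By; rewrite -(integral_cst lam mB); apply: ge0_le_integral => //.
- by move=> x _; rewrite lee_fin (slope_ge0 br).
- by apply/measurable_EFinP; exact: (measurable_D br).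
- by move=> x /By h; rewrite lee_fin (slope_nd br).
Qed.

Lemma integral_D_le (B : set (measurableTypeR R)) y : measurable B ->
  (forall x, B x -> y <= x) -> (\int[lam]_(x in B) (D x)%:E <= (D y)%:E * lam B)%E.
Proof.
move=> mB By; rewrite -(integral_cst lam mB); apply: ge0_le_integral => //.
- by move=> x _; rewrite lee_fin (slope_ge0 br).
- by apply/measurable_EFinP; exact: (measurable_D br).
- by move=> x /By h; rewrite lee_fin (slope_nd br).
Qed.

(** Discarding the right preimage is harmless for a lower bound. The condition [q < 0] keeps the
    image away from 1, where the slope, hence the constant, would degenerate. *)
Lemma good_left p q : -1 <= p -> q < 0 -> good p q -> good (sigma p) (sigma q).
Proof.
move=> p1 q0 [c [c0 H]].
have sq : sigma q < 1.
  by rewrite -(lt_branch_inv br (ltW q0) (lexx _)) (branch_inv_1 br (lexx _)).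
exists (c * D (sigma q)); split; first by rewrite mulr_gt0// slope_gt0.
move=> B mB Bpq.
have BO : B `<=` O.
  move=> x /Bpq; rewrite /O/= !in_itv/= => /andP[x1 x2].
  by have := branch_geN1 br p1; lra.
rewrite (mu_inv mB BO).
have mL := measurable_preim_left br mB; have mR := measurable_preim_right br mB.
apply: (@le_trans _ _ (mu (preim_left sigma B))); last first.
  by apply: le_measure; rewrite ?inE//; exact: measurableU.
apply: le_trans (H _ mL _); last first.
  move=> y [/andP[y1 y0] /Bpq]; rewrite /= !in_itv/= => /andP[h1 h2]; apply/andP; split.
    by rewrite ltNge; apply/negP => /(branch_nondecreasing br); rewrite leNgt h1.
  by rewrite ltNge; apply/negP => /(branch_nondecreasing br); rewrite leNgt h2.
rewrite EFinM -muleA; apply: lee_wpmul2l; first by rewrite lee_fin ltW.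
rewrite (lebesgue_preim_left br)//; last first.
  by apply: subset_trans BO _ => x; rewrite /O/J/= !in_itv/= => /andP[-> /ltW].
by apply: integral_D_ge => // x /Bpq; rewrite /= in_itv/= => /andP[_ /ltW].
Qed.

Lemma good_right p q : 0 < p -> q <= 1 -> good p q -> good (sigma (- q)) (sigma (- p)).
Proof.
move=> p0 q1 [c [c0 H]]; have np0 : - p < 0 by lra.
have sq : sigma (- p) < 1.
  by rewrite -(lt_branch_inv br (ltW np0) (lexx _)) (branch_inv_1 br (lexx _)).
exists (c * D (sigma (- p))); split; first by rewrite mulr_gt0// slope_gt0.
move=> B mB Bpq.
have BO : B `<=` O.
  have nq1 : -1 <= - q by lra.
  move=> x /Bpq; rewrite /O/= !in_itv/= => /andP[x1 x2].
  by have := branch_geN1 br nq1; lra.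
rewrite (mu_inv mB BO).
have mL := measurable_preim_left br mB; have mR := measurable_preim_right br mB.
apply: (@le_trans _ _ (mu (preim_right sigma B))); last first.
  by apply: le_measure; rewrite ?inE//; exact: measurableU.
apply: le_trans (H _ mR _); last first.
  move=> y [/andP[y1 y0] /Bpq]; rewrite /= !in_itv/= => /andP[h1 h2].
  apply/andP; split; rewrite -ltrN2 ltNge; apply/negP => /(branch_nondecreasing br).
    by rewrite leNgt h2.
  by rewrite leNgt h1.
rewrite EFinM -muleA; apply: lee_wpmul2l; first by rewrite lee_fin ltW.
rewrite (lebesgue_preim_right br)//; last first.
  by apply: subset_trans BO _ => x; rewrite /O/J/= !in_itv/= => /andP[-> /ltW].
by apply: integral_D_ge => // x /Bpq; rewrite /= in_itv/= => /andP[_ /ltW].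
Qed.

(** Expansion degenerates only at -1. The right half of the image of [p, q] stays at distance at
    least [l / 2] from -1, and there the inverse branch contracts by the factor
    [D (-1 + l / 2) < 1]; on the left half it does not expand. *)
Lemma expansion l : 0 < l -> exists g : R, 0 < g /\ forall p q, -1 <= p -> q <= 0 ->
  l <= q - p -> q - p + g <= sigma q - sigma p.
Proof.
move=> l0; have Dl : D (-1 + l / 2) < 1 by apply: slope_lt1; lra.
exists ((1 - D (-1 + l / 2)) * (l / 2)); split; first by rewrite mulr_gt0; lra.
move=> p q p1 q0 lpq; have pq : p <= q by lra.
have := branch_expanding br pq q0 => e1.
have sp := branch_geN1 br p1.
pose m := (sigma p + sigma q) / 2.
have pm : sigma p <= m by rewrite /m; lra.
have mq : m <= sigma q by rewrite /m; lra.
have := chord_le br mq; have := chord_le br pm.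
rewrite !(branchK br)//; last lra.
have : D m <= D (-1 + l / 2) by apply: (slope_nd br); rewrite /m; lra.
have : D (sigma p) <= 1 by exact: (slope_le1 br).
have -> : sigma q - m = (sigma q - sigma p) / 2 by rewrite /m; field.
have -> : m - sigma p = (sigma q - sigma p) / 2 by rewrite /m; field.
set d := D (-1 + _) in Dl *; move: (psi m) (D m) (D (sigma p)) => y d1 d2.
move=> h1 h2 h3 h4.
have h5 : d1 * ((sigma q - sigma p) / 2) <= d * ((sigma q - sigma p) / 2).
  by apply: ler_wpM2r => //; lra.
have h6 : d2 * ((sigma q - sigma p) / 2) <= 1 * ((sigma q - sigma p) / 2).
  by apply: ler_wpM2r => //; lra.
have h7 : (1 - d) * (l / 2) <= (1 - d) * ((sigma q - sigma p) / 2).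
  by apply: ler_wpM2l; lra.
lra.
Qed.

Lemma good_sub p q p' q' : p <= p' -> q' <= q -> good p q -> good p' q'.
Proof.
move=> pp qq [c [c0 H]]; exists c; split=> // B mB Bpq; apply: H => // x /Bpq.
by rewrite /= !in_itv/= => /andP[h1 h2]; lra.
Qed.

(* A good interval avoiding 0 has a good image, longer by a definite amount. *)
Lemma good_around0 p0 q0 : -1 <= p0 -> p0 < q0 -> q0 <= 1 -> good p0 q0 ->
  exists p q, [/\ -1 <= p, p < 0, 0 < q, q <= 1 & good p q].
Proof.
move=> p01 pq0 q01 gpq0; apply: contrapT => nex.
pose l := (q0 - p0) / 2; have l0 : 0 < l by rewrite /l; lra.
have [g [g0 H]] := expansion l0.
(* Trimming by [eta] keeps the interval off the cusp. It costs at most half of the gain [g], and at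
   least the length [l] required by the expansion remains. *)
pose eta := Num.min (g / 2) l.
have eta0 : 0 < eta by rewrite lt_min l0 andbT; lra.
have eta1 : eta <= g / 2 by rewrite ge_min lexx.
have eta2 : eta <= l by rewrite ge_min lexx orbT.
have iter n : exists p q, [/\ -1 <= p, q <= 1, 2 * l + n%:R * (g / 2) <= q - p & good p q].
  elim: n => [|n [p [q [p1 q1 lpq gpq]]]].
    by exists p0, q0; split => //; rewrite mulr0n mul0r /l; lra.
  have n0 : 0 <= n%:R * (g / 2) by rewrite mulr_ge0//; lra.
  have [q0'|q0'] := leP q 0.
    have e1 : (q - eta) - p + g <= sigma (q - eta) - sigma p by apply: H => //; lra.
    exists (sigma p), (sigma (q - eta)); split.
    - exact: (branch_geN1 br).
    - by apply: (branch_le1 br); lra.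
    - by rewrite -[n.+1%:R]natr1; lra.
    - apply: good_left => //; first lra.
      by apply: good_sub gpq => //; lra.
  have [p0'|p0'] := leP 0 p; last first.
    by exfalso; apply: nex; exists p, q.
  have e1 : - (p + eta) - - q + g <= sigma (- (p + eta)) - sigma (- q) by apply: H; lra.
  exists (sigma (- q)), (sigma (- (p + eta))); split.
  - by apply: (branch_geN1 br); lra.
  - by apply: (branch_le1 br); lra.
  - by rewrite -[n.+1%:R]natr1; lra.
  - apply: good_right => //; first lra.
    by apply: good_sub gpq => //; lra.
have [n hn] : exists n : nat, 2 / (g / 2) < n%:R.
  by exists (Num.Def.archi_bound (2 / (g / 2))); apply: archi_boundP; rewrite divr_ge0//; lra.
have [p [q [p1 q1 lpq _]]] := iter n.
move: hn; rewrite ltr_pdivrMr; lra.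
Qed.

End bounds.

(** * Existence of an interval carrying a lower bound *)

Section good_interval.
Context (R : realType) (sigma psi D : R -> R).
Hypothesis br : cusp_branch sigma psi D.
Notation lam := (@lebesgue_measure R).
Variable mu : {measure set (measurableTypeR R) -> \bar R}.
Let O : set (measurableTypeR R) := `]-1, 1[%classic.
Let mO : measurable O. Proof. exact: measurable_itv. Qed.
Hypothesis mu1 : (mu O = 1)%E.
Hypothesis mu_inv : forall B : set (measurableTypeR R), measurable B -> B `<=` O ->
  mu B = mu (preim_left sigma B `|` preim_right sigma B).
Hypothesis mu_approx : forall e, 0 < e -> exists f u, admissible mu f u e.

Lemma mu_tail (e : R) : 0 < e ->
  exists s : R, -1 < s < 0 /\ ((1 - e)%:E <= mu `]s, 1%R[%classic)%E.
Proof.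
move=> e0.
(* The index shift makes the left end at most [-1 / 2], hence negative. *)
pose F (n : nat) : set (measurableTypeR R) := `](-1 + n.+2%:R^-1), 1[%classic.
have mF n : measurable (F n) by exact: measurable_itv.
have FO : \bigcup_n F n = O.
  apply/seteqP; split => x.
    move=> [n _]; rewrite /F/O/= !in_itv/= => /andP[h ->]; rewrite andbT.
    by apply: lt_trans h; rewrite ltrDl invr_gt0.
  rewrite /O/= in_itv/= => /andP[x1 x2].
  exists (Num.Def.archi_bound (x + 1)^-1) => //=; rewrite /F/= in_itv/= x2 andbT.
  set n := Num.Def.archi_bound _.
  have x10 : 0 < x + 1 by lra.
  have : (x + 1)^-1 < n.+2%:R.
    apply: lt_trans (archi_boundP _) _; first by rewrite invr_ge0 ltW.
    by rewrite ltr_nat ltnW.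
  by move=> h; rewrite addrC -ltrBrDr opprK invf_plt ?posrE.
have ndF : nondecreasing_seq F.
  apply/nondecreasing_seqP => n; apply/subsetPset => x; rewrite /F/= !in_itv/= => /andP[h ->].
  rewrite andbT; apply: le_lt_trans h; rewrite lerD2l lef_pV2 ?posrE// ler_nat//.
have mUF : measurable (\bigcup_n F n) by rewrite FO.
have : (mu \o F) n @[n --> \oo] --> 1%E.
  by rewrite -mu1 -FO; exact: nondecreasing_cvg_mu.
move=> /fine_cvgP[finF /cvgrPdist_lt /(_ e e0) ev].
have [n [fn hn]] : exists n, mu (F n) \is a fin_num /\ `|1 - fine (mu (F n))| < e.
  near \oo => n; exists n; split; first by near: n.
  by near: n.
exists (-1 + n.+2%:R^-1); split.
  apply/andP; split; first by rewrite ltrDl invr_gt0.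
  have h2 : n.+2%:R^-1 <= 2^-1 :> R by rewrite lef_pV2 ?posrE// ler_nat.
  by rewrite addrC subr_lt0; apply: le_lt_trans h2 _; lra.
rewrite -[X in (_ <= X)%E](fineK fn) lee_fin; move: hn; rewrite ltr_norml; lra.
Unshelve. all: by end_near.
Qed.

(* Otherwise every cell of a fine partition of [s, 1] has a point where [f] is small;
   the oscillations over the cells add up to at most [u s], so that [f] carries too
   little mass on [s, 1]. *)
Lemma exists_good : exists p q : R, [/\ -1 <= p, p < q, q <= 1 & good mu p q].
Proof.
have h20 : 0 < 1 / 2 :> R by lra.
have [s [s10 mus]] := mu_tail h20; have /andP[s1 s0] := s10.
have mu_le1 : (mu O <= 1)%E by rewrite mu1.
have [C0 desc] := descent br mu_le1 mu_inv s10.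
apply: contrapT => nex.
(* The mesh gives [h * u s <= 1 / 8], so that [f] would have mass at most
   [(1 - s) / 16 + 1 / 8 < 1 / 4] on [s, 1]; it has at least [1 / 2 - e >= 3 / 8]. *)
pose N := (Num.Def.archi_bound (16 * (Num.max C0 0 + 1))).+1.
pose h := (1 - s) / N%:R.
pose P (i : nat) := s + h *+ i.
have N0 : 0 < N%:R :> R by rewrite ltr0n.
have h0 : 0 < h by rewrite divr_gt0//; lra.
have PN : P N = 1 by rewrite /P -mulr_natr divfK ?gt_eqF//; lra.
have PS i : P i.+1 = P i + h by rewrite /P mulrSr addrA.
have Ps i : s <= P i by rewrite /P lerDl mulrn_wge0// ltW.
have P1 i : (i <= N)%N -> P i <= 1.
  by move=> iN; rewrite -PN /P lerD2l -[h *+ i]mulr_natr -[h *+ N]mulr_natr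
    ler_wpM2l ?(ltW h0)// ler_nat.
have hC c : 0 <= c -> c <= C0 -> h * c <= 1 / 8.
  move=> c0 cC; rewrite /h mulrAC ler_pdivrMr//.
  have hN : 16 * (Num.max C0 0 + 1) < N%:R.
    apply: lt_le_trans (archi_boundP _) _; last by rewrite ler_nat.
    by rewrite mulr_ge0// addr_ge0// le_max lexx orbT.
  have : C0 <= Num.max C0 0 by rewrite le_max lexx.
  have : (1 - s) * c <= 2 * c by apply: ler_wpM2r => //; lra.
  lra.
have bad i : (i < N)%N -> exists B : set (measurableTypeR R), [/\ measurable B,
    B `<=` `]P i, P i.+1[%classic & (mu B < (1 / 16)%:E * lam B)%E].
  move=> iN; apply: contrapT => nB; apply: nex; exists (P i), (P i.+1); split.
  - exact: le_trans (ltW s1) (Ps i).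
  - by rewrite PS ltrDl.
  - exact: P1.
  exists (1 / 16); split; first lra.
  move=> B mB BP; rewrite leNgt; apply/negP => hB; apply: nB.
  by exists B.
(* The strict inequalities on finitely many cells leave a common margin [e]. It has to be fixed
   before the approximation [f], whose accuracy is [e]. *)
have [e [e0 e1 He]] : exists e : R, [/\ 0 < e, e <= 1 / 8 & forall i, (i < N)%N ->
    exists B : set (measurableTypeR R), [/\ measurable B,
    B `<=` `]P i, P i.+1[%classic & (mu B + e%:E < (1 / 16)%:E * lam B)%E]].
  suff H n : (n <= N)%N -> exists e : R, [/\ 0 < e, e <= 1 / 8 & forall i, (i < n)%N ->
    exists B : set (measurableTypeR R), [/\ measurable B,
    B `<=` `]P i, P i.+1[%classic & (mu B + e%:E < (1 / 16)%:E * lam B)%E]].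
    exact: H (leqnn _).
  elim: n => [_|n IH nN]; first by exists (1 / 8); split => //; lra.
  have [e [e0 e1 He]] := IH (ltnW nN).
  have [B [mB BP muB]] := bad n nN.
  have [e' e'0 muB'] : exists2 e' : R, 0 < e' & (mu B + e'%:E < (1 / 16)%:E * lam B)%E.
    have mfin : mu B \is a fin_num.
      rewrite ge0_fin_numE//; exact: lt_le_trans muB (leey _).
    have lfin : lam B \is a fin_num.
      rewrite ge0_fin_numE//; apply: le_lt_trans (_ : lam O < +oo)%E; last first.
        by rewrite lebesgue_measure_itv/= lte_fin; case: ifP => // _; rewrite -EFinD ltry.
      apply: le_measure; rewrite ?inE// => x /BP; rewrite /O/= !in_itv/= => /andP[x1 x2].
      by have := P1 _ nN; have := Ps n; lra.
    move: muB; rewrite -(fineK mfin) -(fineK lfin) -EFinM lte_fin => muB.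
    exists ((1 / 16 * fine (lam B) - fine (mu B)) / 2); first lra.
    by rewrite -EFinD lte_fin; lra.
  exists (Num.min e e'); split.
  - by rewrite lt_min e0.
  - by rewrite ge_min e1.
  - move=> i; rewrite ltnS leq_eqVlt => /predU1P[->|iln].
      exists B; split => //; apply: le_lt_trans muB'; apply: leeD => //.
      by rewrite lee_fin ge_min lexx orbT.
    have [B' [mB' B'P muB'']] := He i iln; exists B'; split => //.
    by apply: le_lt_trans muB''; apply: leeD => //; rewrite lee_fin ge_min lexx.
have [f0 [u0 a0]] := mu_approx e0.
have e11 : e <= 1 by lra.
have [f [u [a us]]] := desc f0 u0 e e11 a0.
have [fge0 uf u1 nf] := a.
have mf (A : set R) : measurable A -> measurable_fun A f.
  by move=> mA; exact: (measurable_controlled uf).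
have small i : (i < N)%N -> exists2 z, P i <= z <= P i.+1 & f z <= 1 / 16.
  move=> iN; have [B [mB BP muB]] := He i iN; apply: contrapT => nz.
  have BO : B `<=` O.
    move=> x /BP; rewrite /O/= !in_itv/= => /andP[x1 x2].
    by have := P1 _ iN; have := Ps i; lra.
  have [hB _] := nf B mB BO; have := le_lt_trans hB muB; rewrite ltNge => /negP; apply.
  rewrite -(integral_cst lam mB); apply: ge0_le_integral => //.
  - by move=> x _; rewrite lee_fin; lra.
  - by apply/measurable_EFinP; exact: mf.
  - move=> x /BP; rewrite /= in_itv/= => /andP[x1 x2]; rewrite lee_fin leNgt.
    apply/negP => fx; apply: nz; exists x; last exact: ltW.
    by rewrite (ltW x1) (ltW x2).
have piece i : (i < N)%N -> (\int[lam]_(x in `]P i, P i.+1]) (f x)%:E <=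
    (h * (1 / 16 + (u (P i) - u (P i.+1))))%:E)%E.
  move=> iN; have [z /andP[z1 z2] fz] := small i iN.
  pose I : set (measurableTypeR R) := `]P i, P i.+1]%classic.
  have mI : measurable I by exact: measurable_itv.
  have lI : lam I = h%:E.
    by rewrite lebesgue_itvoc PS ?lerDl ?(ltW h0)// addrAC subrr add0r.
  rewrite mulrC EFinM -lI -(integral_cst lam mI); apply: ge0_le_integral => //.
  - by move=> x _; rewrite lee_fin.
  - by apply/measurable_EFinP; exact: mf.
  - move=> x; rewrite /I/= in_itv/= => /andP[x1 x2]; rewrite lee_fin.
    have und := controls_nonincreasing uf.
    have [xz|/ltW zx] := leP x z.
      by have := controls_le uf xz; have := und _ _ (ltW x1); have := und _ _ z2; lra.
    by have := controls_ge uf zx; have := und _ _ z1; have := und _ _ x2; lra.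
have total n : (n <= N)%N -> (\int[lam]_(x in `]s, P n]) (f x)%:E <=
    (h * (n%:R * (1 / 16) + (u s - u (P n))))%:E)%E.
  elim: n => [_|n IH nN].
    rewrite (_ : P 0%N = s); last by rewrite /P mulr0n addr0.
    by rewrite set_itvoc0 integral_set0 mulr0n mul0r subrr addr0 mulr0.
  rewrite (@itv_bndbnd_setU _ _ _ (BRight (P n))) ?bnd_simp//; last by rewrite PS lerDl ltW.
  rewrite ge0_integral_setU//=; last 3 first.
  - by apply/measurable_EFinP; apply: mf; apply: measurableU; exact: measurable_itv.
  - by move=> x _; rewrite lee_fin.
  - apply/disj_setPS => t /= []; rewrite !in_itv/= => /andP[_ ty] /andP[yt _].
    by move: (lt_le_trans yt ty); rewrite ltxx.
  apply: le_trans (leeD (IH (ltnW nN)) (piece n nN)) _.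
  by rewrite -EFinD lee_fin -[n.+1%:R]natr1; lra.
have us0 := control_ge0 uf u1 s.
have := total N (leqnn _); rewrite PN (u1 1 (lexx _)) subr0 mulrDr.
have -> : h * (N%:R * (1 / 16)) = (1 - s) / 16.
  by rewrite /h; field; rewrite gt_eqF.
have := hC _ us0 us.
have mS : measurable (`]s, 1[%classic : set (measurableTypeR R)) by exact: measurable_itv.
have SO : (`]s, 1[%classic : set (measurableTypeR R)) `<=` O.
  by move=> x; rewrite /O/= !in_itv/= => /andP[]; lra.
have [_ h1] := nf _ mS SO.
have h2 := le_trans mus h1; move: h2.
rewrite integral_itv_bndo_bndc; last by apply/measurable_EFinP; exact: mf.
move: (\int[lam]_(x in _) _)%E => I h2 h3 h4.
have := le_trans h2 (leeD2r e%:E h4).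
by rewrite -EFinD lee_fin; lra.
Qed.

End good_interval.

(** * The invariant measure near 0, near 1 and near the neutral point *)

Section endpoints.
Context (R : realType) (sigma psi D : R -> R).
Hypothesis br : cusp_branch sigma psi D.
Notation lam := (@lebesgue_measure R).
Variable mu : {measure set (measurableTypeR R) -> \bar R}.
Let J : set (measurableTypeR R) := `]-1, 1]%classic.
Let O : set (measurableTypeR R) := `]-1, 1[%classic.
Let mO : measurable O. Proof. exact: measurable_itv. Qed.
Hypothesis mu1 : (mu O = 1)%E.
Hypothesis mu_inv : forall B : set (measurableTypeR R), measurable B -> B `<=` O ->
  mu B = mu (preim_left sigma B `|` preim_right sigma B).
Hypothesis mu_approx : forall e, 0 < e -> exists f u, admissible mu f u e.

Lemma mu_around0 : exists a c C : R, [/\ 0 < a, a < 1, 0 < c, 0 <= C &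
  forall B : set (measurableTypeR R), measurable B -> B `<=` `]- a, a[%classic ->
    (c%:E * lam B <= mu B)%E /\ (mu B <= C%:E * lam B)%E].
Proof.
have s0 : -1 < (- (1 / 2) : R) < 0 by lra.
have [C [C0 HC]] := mu_upper br mu1 mu_inv mu_approx s0.
have [p0 [q0 [h1 h2 h3 gpq]]] := exists_good br mu1 mu_inv mu_approx.
have [p [q [p1 p0' q0' q1 [c [c0 Hc]]]]] := good_around0 br mu_inv h1 h2 h3 gpq.
pose a := Num.min (1 / 2) (Num.min (- p) q).
have ap : a <= - p by rewrite /a !ge_min lexx orbT.
have aq : a <= q by rewrite /a !ge_min lexx !orbT.
have a2 : a <= 1 / 2 by rewrite /a !ge_min lexx.
have a0 : 0 < a by rewrite /a !lt_min oppr_gt0 p0' q0' andbT; lra.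
exists a, c, C; split => //; first lra.
move=> B mB Ba; split.
- by apply: Hc => // x /Ba; rewrite /= !in_itv/= => /andP[]; lra.
- by apply: HC => // x /Ba; rewrite /= !in_itv/= => /andP[]; lra.
Qed.

Lemma mu_near1 : exists x1 c C : R, [/\ -1 < x1, x1 < 1, 0 < c, 0 <= C &
  forall B : set (measurableTypeR R), measurable B -> B `<=` `]x1, 1[%classic ->
    (c%:E * (\int[lam]_(x in B) (D x)%:E) <= mu B)%E /\
    (mu B <= C%:E * (\int[lam]_(x in B) (D x)%:E))%E].
Proof.
have [a [c [C [a0 a1 c0 C0 H]]]] := mu_around0.
have na : - a <= 0 by lra.
have sa1 : sigma (- a) < 1.
  by rewrite -(lt_branch_inv br na (lexx _)) (branch_inv_1 br (lexx _)); lra.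
have sa0 : -1 < sigma (- a).
  have n1 : -1 < - a by lra.
  by have := branch_gt br n1 na; lra.
(* To the right of [sigma (- a)] both preimages lie in []- a, a[]. The factor 2 counts them; one of
   them is enough for the lower bound. *)
exists (sigma (- a)), c, (2 * C); split => //; first lra.
move=> B mB Ba.
have BO : B `<=` O.
  by move=> x /Ba; rewrite /O/= !in_itv/= => /andP[]; lra.
have BJ : B `<=` J.
  by move=> x /Ba; rewrite /J/= !in_itv/= => /andP[]; lra.
have mL := measurable_preim_left br mB; have mR := measurable_preim_right br mB.
have La y : preim_left sigma B y -> - a < y /\ y < a.
  move=> [/andP[y1 y0] /Ba]; rewrite /= in_itv/= => /andP[h _].
  suff : - a < y by lra.
  by rewrite ltNge; apply/negP => /(branch_nondecreasing br); rewrite leNgt h.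
have LRa : preim_left sigma B `|` preim_right sigma B `<=` `]- a, a[%classic.
  by move=> y [/La|/La] []; rewrite /= in_itv/=; lra.
have mLR := measurableU _ _ mL mR.
have [H1 H2] := H _ mLR LRa.
rewrite (mu_inv mB BO); split.
- apply: le_trans H1; apply: lee_wpmul2l; first by rewrite lee_fin ltW.
  rewrite -(lebesgue_preim_left br mB BJ).
  by apply: le_measure; rewrite ?inE.
- apply: le_trans H2 _; rewrite [2 * C]mulrC EFinM -muleA.
  apply: lee_wpmul2l; first by rewrite lee_fin.
  apply: (@le_trans _ _ (lam (preim_left sigma B) + lam (preim_right sigma B))%E).
    exact: measureU2.
  rewrite (lebesgue_preim_left br mB BJ) (lebesgue_preim_right br mB BJ).
  by rewrite (_ : 2%:E = (1 + 1)%E) ?ge0_muleDl ?mul1e.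
Qed.

Lemma mu_near1_le (e : R) : 0 < e -> exists x1 : R, x1 < 1 /\
  forall B : set (measurableTypeR R), measurable B -> B `<=` `]x1, 1[%classic ->
    (mu B <= e%:E * lam B)%E.
Proof.
move=> e0; have [x1 [c [C [x10 x11 c0 C0 H]]]] := mu_near1.
(* [C] may be 0, hence the [+ 1]. *)
have eC : 0 < e / (C + 1) by rewrite divr_gt0//; lra.
have [t [/andP[t1 t2] Dt]] := slope_small br eC.
exists (Num.max x1 t); split; first by rewrite gt_max x11 t2.
move=> B mB Bx.
have Bx1 : B `<=` `]x1, 1[%classic.
  by move=> x /Bx; rewrite /= !in_itv/= gt_max => /andP[/andP[-> _] ->].
have [_ h] := H B mB Bx1; apply: le_trans h _.
apply: (@le_trans _ _ (C%:E * ((D t)%:E * lam B))%E).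
  apply: lee_wpmul2l; first by rewrite lee_fin.
  apply: (integral_D_le br mB) => x /Bx; rewrite /= in_itv/= gt_max => /andP[/andP[_ /ltW]] //.
rewrite muleA -EFinM; apply: lee_wpmul2r; first exact: measure_ge0.
rewrite lee_fin; apply: le_trans (_ : C * (e / (C + 1)) <= _); first exact: ler_wpM2l.
rewrite mulrA ler_pdivrMr; last lra.
by rewrite mulrC ler_wpM2l; lra.
Qed.

(** The displacement [z - psi z] is nondecreasing since [psi] has slope at most 1; as long as the
    iterates stay above [t], each step goes left by at least [t - psi t]. *)
Lemma branch_inv_iter_small x t : -1 < t -> exists n, iter n psi x <= t.
Proof.
move=> t1; apply: contrapT => nex.
have big n : t < iter n psi x.
  by rewrite ltNge; apply/negP => h; apply: nex; exists n.
have d0 : 0 < t - psi t by rewrite subr_gt0 (branch_inv_lt br).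
have step n : iter n psi x <= x - n%:R * (t - psi t).
  elim: n => [|n IH]; first by rewrite mulr0n mul0r subr0.
  have tn := ltW (big n).
  have := chord_le br tn; have := slope_le1 br t.
  rewrite /= -[n.+1%:R]natr1.
  move: (iter n psi x) tn IH => z tz IH D1 h.
  have : D t * (z - t) <= 1 * (z - t) by apply: ler_wpM2r => //; lra.
  lra.
have xt : 0 <= x - t by have := big 0%N; rewrite /=; lra.
have h := archi_boundP (divr_ge0 xt (ltW d0)).
have := step (Num.Def.archi_bound ((x - t) / (t - psi t))).
have := big (Num.Def.archi_bound ((x - t) / (t - psi t))).
by move: h; rewrite ltr_pdivrMr//; lra.
Qed.

Lemma preim_left_sub (B : set (measurableTypeR R)) r : r <= 1 ->
  B `<=` `]-1, r[%classic -> preim_left sigma B `<=` `]-1, psi r[%classic.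
Proof.
move=> r1 Br y [/andP[y1 y0] /Br]; rewrite /= !in_itv/= (lt_branch_inv br)// => /andP[s1 ->].
rewrite andbT lt_neqAle y1 andbT; apply/eqP => yE.
by move: s1; rewrite -yE (branchN1 br) ltxx.
Qed.

(* The inequality telescopes along the iterated left preimages of [B], which shrink
   to -1. *)
Lemma compare_measures (al be : set (measurableTypeR R) -> \bar R) (r : R) :
  r <= 1 ->
  (forall A, (0 <= be A)%E) ->
  (forall A, measurable A -> A `<=` O -> al A \is a fin_num /\ be A \is a fin_num) ->
  (forall A B, measurable A -> measurable B -> A `<=` B -> (al A <= al B)%E) ->
  (forall e : R, 0 < e -> exists t : R, -1 < t /\ (al `](-1)%R, t[%classic <= e%:E)%E) ->
  (forall B, measurable B -> B `<=` `]-1, r[%classic ->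
    (al B + be (preim_left sigma B) <= al (preim_left sigma B) + be B)%E) ->
  forall B, measurable B -> B `<=` `]-1, r[%classic -> (al B <= be B)%E.
Proof.
move=> r1 be0 fin al_le al_small step B mB Br.
have rO (x : R) : x <= r -> `]-1, x[%classic `<=` O.
  by move=> xr y; rewrite /O/= !in_itv/= => /andP[]; lra.
pose L := preim_left sigma.
have Ln n : measurable (iter n L B) /\ iter n L B `<=` `]-1, iter n psi r[%classic /\
    iter n psi r <= r.
  elim: n => [//|n [mn [sn rn]]]; split; [|split].
  - exact: (measurable_preim_left br).
  - by apply: preim_left_sub => //; exact: le_trans rn r1.
  - exact: le_trans (branch_inv_le br _) rn.
have main n : (al B + be (iter n L B) <= al (iter n L B) + be B)%E.
  elim: n => [//|n IH]; have [mn [sn rn]] := Ln n; have [mn' [sn' rn']] := Ln n.+1.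
  have snr : iter n L B `<=` `]-1, r[%classic.
    by move=> y /sn; rewrite /= !in_itv/= => /andP[]; lra.
  have [f1 f2] := fin _ mn (subset_trans sn (rO _ rn)).
  have [f3 f4] := fin _ mn' (subset_trans sn' (rO _ rn')).
  have [f5 f6] := fin _ mB (subset_trans Br (rO _ (lexx _))).
  have := step _ mn snr; rewrite -/(iter n.+1 L B); move: IH.
  rewrite -(fineK f1) -(fineK f2) -(fineK f3) -(fineK f4) -(fineK f5) -(fineK f6).
  by rewrite -!EFinD !lee_fin; lra.
apply/lee_addgt0Pr => e e0; have [t [t1 alt]] := al_small e e0.
have [n hn] := branch_inv_iter_small r t1.
have [mn [sn rn]] := Ln n.
apply: (@le_trans _ _ (al B + be (iter n L B))%E); first exact: leeDl.
apply: le_trans (main n) _; rewrite addeC; apply: leeD => //.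
apply: le_trans alt; apply: al_le => // y /sn; rewrite /= !in_itv/= => /andP[]; lra.
Qed.

Lemma mu_small (e : R) : 0 < e -> exists t : R, -1 < t /\ (mu `](-1)%R, t[%classic <= e%:E)%E.
Proof.
move=> e0; have [s [/andP[s1 s0] h]] := mu_tail mu1 e0.
exists s; split => //.
pose A : set (measurableTypeR R) := `]-1, s[%classic.
pose B : set (measurableTypeR R) := `]s, 1[%classic.
have mA : measurable A by exact: measurable_itv.
have mB : measurable B by exact: measurable_itv.
have AO : A `<=` O by move=> x; rewrite /A/O/= !in_itv/= => /andP[]; lra.
have BO : B `<=` O by move=> x; rewrite /B/O/= !in_itv/= => /andP[]; lra.
have fO : mu O \is a fin_num by rewrite mu1.
have fin X : measurable X -> X `<=` O -> mu X \is a fin_num.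
  move=> mX XO; rewrite ge0_fin_numE//; apply: (@le_lt_trans _ _ (mu O)).
    by apply: le_measure; rewrite ?inE.
  by rewrite mu1 ltry.
have : (mu A + mu B <= 1%:E)%E.
  rewrite -[X in (_ <= X)%E]mu1 -measureU//.
    by apply: le_measure; rewrite ?inE//; [exact: measurableU|move=> x [/AO|/BO]].
  by apply/seteqP; split => // x []; rewrite /A/B/= !in_itv/= => /andP[_ xs] /andP[sx _]; lra.
move: h; rewrite -/A -/B -(fineK (fin _ mA AO)) -(fineK (fin _ mB BO)).
by rewrite -EFinD !lee_fin; lra.
Qed.

Section neutral_point.
Variables (x1 c C : R).
Hypotheses (c0 : 0 <= c) (C0 : 0 <= C)
  (near1 : forall B : set (measurableTypeR R), measurable B -> B `<=` `]x1, 1[%classic ->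
    (c%:E * (\int[lam]_(x in B) (D x)%:E) <= mu B)%E /\
    (mu B <= C%:E * (\int[lam]_(x in B) (D x)%:E))%E).
Variable r : R.
Hypotheses (r0 : r < 1) (rx1 : x1 <= - psi r).

Let sub_O B : B `<=` `]-1, r[%classic -> B `<=` O.
Proof. by move=> Br x /Br; move: r0; rewrite /O/= !in_itv/= => ? /andP[]; lra. Qed.

Let sub_J B : B `<=` `]-1, r[%classic -> B `<=` J.
Proof. by move=> Br x /Br; move: r0; rewrite /J/= !in_itv/= => ? /andP[]; lra. Qed.

Let mu_split B : measurable B -> B `<=` `]-1, r[%classic ->
  (mu B = mu (preim_left sigma B) + mu (preim_right sigma B))%E.
Proof.
move=> mB Br; rewrite mu_inv//; last exact: sub_O.
have mL := measurable_preim_left br mB; have mR := measurable_preim_right br mB.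
rewrite measureU//; apply/seteqP; split => // x.
by move=> /(preim_cap br (sub_O Br)).
Qed.

Let right_sub (B : set (measurableTypeR R)) : B `<=` `]-1, r[%classic ->
  preim_right sigma B `<=` `]x1, 1[%classic.
Proof.
move=> Br y /(preim_left_sub (ltW r0) Br); move: rx1; rewrite /= !in_itv/= => ? /andP[]; lra.
Qed.

Let integral_right (B : set (measurableTypeR R)) : measurable B -> B `<=` `]-1, r[%classic ->
  (\int[lam]_(y in preim_right sigma B) (D y)%:E =
   \int[lam]_(x in B) (D (- psi x) * D x)%:E)%E.
Proof.
move=> mB Br; rewrite (ge0_integral_preim_right br (g := EFin \o D))//.
- exact: sub_J.
- by apply/measurable_EFinP; exact: (measurable_D br).
- by move=> x /=; rewrite lee_fin (slope_ge0 br).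
Qed.

Let mDpsi (A : set R) : measurable A -> measurable_fun A (fun x : R => D (- psi x) * D x).
Proof.
move=> mA; apply: measurable_funM; last exact: (measurable_D br).
apply: (measurableT_comp (measurable_D br measurableT)).
apply: (measurableT_comp _ (measurable_branch_inv br mA)); exact: oppr_measurable.
Qed.

Let fin_O K (A : set (measurableTypeR R)) : measurable A -> A `<=` O ->
  mu A \is a fin_num /\ (K%:E * lam A)%E \is a fin_num.
Proof.
move=> mA AO; split.
  rewrite ge0_fin_numE//; apply: (@le_lt_trans _ _ (mu O)).
    by apply: le_measure; rewrite ?inE.
  by rewrite mu1 ltry.
rewrite fin_numM// ge0_fin_numE//; apply: (@le_lt_trans _ _ (lam O)).
  by apply: le_measure; rewrite ?inE.
by rewrite lebesgue_measure_itv/= lte_fin; case: ifP => // _; rewrite -EFinD ltry.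
Qed.

Lemma mu_nearN1_le (K : R) : 0 <= K ->
  (forall x, -1 < x < r -> C * D (- psi x) <= K * (1 - D x)) ->
  forall B : set (measurableTypeR R), measurable B -> B `<=` `]-1, r[%classic ->
    (mu B <= K%:E * lam B)%E.
Proof.
move=> K0 H; apply: (@compare_measures mu (fun A => K%:E * lam A)%E r (ltW r0)).
- by move=> A; rewrite mule_ge0.
- exact: fin_O.
- by move=> A B mA mB AB; apply: le_measure; rewrite ?inE.
- exact: mu_small.
move=> B mB Br; have mR := measurable_preim_right br mB.
rewrite (mu_split mB Br) -addeA; apply: leeD => //.
have [_ h] := near1 mR (right_sub Br).
rewrite (lebesgue_preim_left br mB (sub_J Br)).
apply: le_trans (leeD2r _ h) _; rewrite (integral_right mB Br).
have mD : measurable_fun B (fun x => (D x)%:E).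
  by apply/measurable_EFinP; exact: (measurable_D br).
have Dpsi0 x : 0 <= D (- psi x) * D x by rewrite mulr_ge0 ?(slope_ge0 br).
have mDp : measurable_fun B (fun x => (D (- psi x) * D x)%:E).
  by apply/measurable_EFinP; exact: mDpsi.
have D0 := slope_ge0 br.
rewrite -!ge0_integralZl_EFin// -?ge0_integralD//; first last.
all: try by [move=> x _; rewrite -?EFinM lee_fin ?mulr_ge0|exact: emeasurable_funM].
rewrite -(integral_cst lam mB); apply: ge0_le_integral => //.
- by move=> x _; rewrite -!EFinM -EFinD lee_fin addr_ge0 ?mulr_ge0.
- by apply: emeasurable_funD; exact: emeasurable_funM.
- move=> x /Br; rewrite /= in_itv/= => xr; rewrite -!EFinM -EFinD lee_fin.
  have h1 := H x xr; have D1 := slope_le1 br x.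
  have : C * (D (- psi x) * D x) <= C * D (- psi x).
    by apply: ler_wpM2l => //; rewrite ler_piMr.
  lra.
Qed.

(** The comparison is used with the roles exchanged: the measure that has to be small near -1 is now
    [M * lam], and the factor [D x] must be kept. *)
Lemma mu_nearN1_ge (M : R) : 0 <= M -> -1 < r ->
  (forall x, -1 < x < r -> M * (1 - D x) <= c * (D (- psi x) * D x)) ->
  forall B : set (measurableTypeR R), measurable B -> B `<=` `]-1, r[%classic ->
    (M%:E * lam B <= mu B)%E.
Proof.
move=> M0 r1 H; apply: (@compare_measures (fun A => M%:E * lam A)%E mu r (ltW r0)).
- by [].
- by move=> A mA AO; have [? ?] := fin_O M mA AO.
- move=> A B mA mB AB; apply: lee_wpmul2l; first by rewrite lee_fin.
  by apply: le_measure; rewrite ?inE.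
- move=> e e0; exists (-1 + e / (M + 1)); have e1 : 0 < e / (M + 1) by rewrite divr_gt0//; lra.
  split; first by rewrite ltrDl.
  have e2 : M * (e / (M + 1)) <= e.
    by rewrite mulrA ler_pdivrMr; [rewrite mulrC ler_wpM2l//; lra|lra].
  rewrite lebesgue_measure_itv/= lte_fin ltrDl e1 -EFinD -EFinM lee_fin.
  by move: (e / (M + 1)) e2 => d; lra.
move=> B mB Br; have mR := measurable_preim_right br mB.
rewrite (mu_split mB Br) addeCA addeC; apply: leeD => //.
have [h _] := near1 mR (right_sub Br).
rewrite (lebesgue_preim_left br mB (sub_J Br)).
apply: le_trans (leeD2l _ h); rewrite (integral_right mB Br).
have mD : measurable_fun B (fun x => (D x)%:E).
  by apply/measurable_EFinP; exact: (measurable_D br).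
have Dpsi0 x : 0 <= D (- psi x) * D x by rewrite mulr_ge0 ?(slope_ge0 br).
have mDp : measurable_fun B (fun x => (D (- psi x) * D x)%:E).
  by apply/measurable_EFinP; exact: mDpsi.
have D0 := slope_ge0 br.
rewrite -!ge0_integralZl_EFin// -?ge0_integralD//; first last.
all: try by [move=> x _; rewrite -?EFinM lee_fin ?mulr_ge0|exact: emeasurable_funM].
rewrite -(integral_cst lam mB); apply: ge0_le_integral => //.
- by apply: emeasurable_funD; exact: emeasurable_funM.
- move=> x /Br; rewrite /= in_itv/= => xr; rewrite -!EFinM -EFinD lee_fin.
  by have := H x xr; lra.
Qed.

End neutral_point.

End endpoints.

(** * Construction of the branch, its concave inverse and the slope from the map *)

Section build_branch.
Context (R : realType) (S : R -> R).
(** [chord] is convexity on the open interval with denominators cleared, [above] reflects the local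
    behaviour at -1, and [cusp] the vertical tangent at 0. *)
Hypotheses (onto : S @` `[-1, 0] = `[-1, 1]%classic)
  (incr : {in `[-1, 0] &, {homo S : x y / x < y}})
  (chord : forall x y z, -1 < x -> x < y -> y < z -> z < 0 ->
     (S y - S x) * (z - y) <= (S z - S y) * (y - x))
  (above : forall d, 0 < d -> exists y, [/\ -1 < y, y < -1 + d, y < 0 & y < S y])
  (cusp : forall e, 0 < e -> exists y, [/\ -1 < y, y < 0 & - y <= e * (1 - S y)]).

Let incr' x y : -1 <= x -> x < y -> y <= 0 -> S x < S y.
Proof.
by move=> x1 xy y0; apply: incr; rewrite // in_itv/=; apply/andP; split; lra.
Qed.

Let range y : -1 <= y -> y <= 0 -> -1 <= S y <= 1.
Proof.
move=> y1 y0; have : (S @` `[-1, 0]) (S y) by exists y => //=; rewrite in_itv/= y1.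
by rewrite onto /= in_itv.
Qed.

Let pre x : -1 <= x -> x <= 1 -> exists y, [/\ -1 <= y, y <= 0 & S y = x].
Proof.
move=> x1 x2; have : `[-1, 1]%classic x by rewrite /= in_itv/= x1.
by rewrite -onto => -[y]; rewrite /= in_itv/= => /andP[y1 y0] <-; exists y.
Qed.

Lemma left_end : S (-1) = -1.
Proof.
have [||y [y1 y0 Sy]] := @pre (-1); [lra|lra|].
have [y1'|] := ltP (-1) y; last by move=> ?; rewrite (_ : -1 = y)//; lra.
have := incr' (lexx _) y1' y0.
have /andP[] := @range (-1) (lexx _) (lerN10 R); lra.
Qed.

Lemma cusp_end : S 0 = 1.
Proof.
have [||y [y1 y0 Sy]] := @pre 1; [lra|lra|].
have [y1'|] := ltP y 0; last by move=> ?; rewrite (_ : 0 = y)//; lra.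
have := incr' y1 y1' (lexx _).
have /andP[] := @range 0 (lerN10 R) (lexx _); lra.
Qed.

Let inv_spec x : exists y, -1 <= x -> x <= 1 -> [/\ -1 <= y, y <= 0 & S y = x].
Proof.
have [/andP[x1 x2]|h] := boolP (-1 <= x <= 1).
  by have [y ?] := pre x1 x2; exists y.
by exists 0 => x1 x2; move: h; rewrite x1 x2.
Qed.

Let psi0 x := sval (cid (inv_spec x)).

Definition psi_of x := if x < -1 then x else if 1 < x then 0 else psi0 x.
Definition sigma_of y := if y < -1 then y else if 0 < y then 1 else S y.

Local Notation psi := psi_of.
Local Notation sigma := sigma_of.

Lemma psi_itv x : -1 <= x -> x <= 1 -> [/\ -1 <= psi x, psi x <= 0 & S (psi x) = x].
Proof.
move=> x1 x2; rewrite /psi_of ltNge x1/= ltNge x2/= /psi0.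
by case: cid => y /= /(_ x1 x2).
Qed.

Lemma psi_out x : x <= -1 -> psi x = x.
Proof.
rewrite le_eqVlt => /predU1P[->|x1]; last by rewrite /psi_of x1.
have [||y1 y0 Sy] := @psi_itv (-1); [lra|lra|].
have [y1'|] := ltP (-1) (psi (-1)); last lra.
by have := incr' (lexx _) y1' y0; rewrite Sy left_end ltxx.
Qed.

Lemma psi_out1 x : 1 <= x -> psi x = 0.
Proof.
rewrite le_eqVlt => /predU1P[<-|x1]; last first.
  by rewrite /psi_of ltNge (_ : -1 <= x) ?x1//; lra.
have [||y1 y0 Sy] := @psi_itv 1; [lra|lra|].
have [y1'|] := ltP (psi 1) 0; last lra.
by have := incr' y1 y1' (lexx _); rewrite Sy cusp_end ltxx.
Qed.

Let nd y z : -1 <= y -> y <= z -> z <= 0 -> S y <= S z.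
Proof. by move=> y1; rewrite le_eqVlt => /predU1P[->//|yz] z0; exact/ltW/incr'. Qed.

Lemma sigma_in y : -1 <= y -> y <= 0 -> sigma y = S y.
Proof. by move=> y1 y0; rewrite /sigma_of ltNge y1/= ltNge y0. Qed.

Lemma sigma_nd : {homo sigma : x y / x <= y}.
Proof.
move=> x y xy; rewrite /sigma_of; case: (ltP x (-1)) => x1; case: (ltP y (-1)) => y1 //.
- have [y0|y0] := ltP 0 y; first lra.
  by have /andP[] := range y1 y0; lra.
- by exfalso; lra.
- have [x0|x0] := ltP 0 x; have [y0|y0] := ltP 0 y => //; first lra.
    by have /andP[] := range x1 x0.
  exact: nd.
Qed.

Lemma psi_sigma y : y <= 0 -> psi (sigma y) = y.
Proof.
move=> y0; rewrite /sigma_of; case: (ltP y (-1)) => y1; first by rewrite psi_out// ltW.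
rewrite ltNge y0/=; have /andP[s1 s2] := range y1 y0.
have [z1 z0 Sz] := psi_itv s1 s2.
have [h|h|//] := ltgtP (psi (S y)) y.
  by have := incr' z1 h y0; rewrite Sz ltxx.
by have := incr' y1 h z0; rewrite Sz ltxx.
Qed.

Lemma sigma_psi x : x <= 1 -> sigma (psi x) = x.
Proof.
move=> x1; have [h|h] := ltP x (-1).
  by rewrite psi_out ?ltW// /sigma_of h.
by have [z1 z0 Sz] := psi_itv h x1; rewrite sigma_in.
Qed.

Lemma psi_le0 x : psi x <= 0.
Proof.
have [h|h] := leP x (-1); first by rewrite psi_out//; lra.
have [h'|h'] := leP 1 x; first by rewrite psi_out1.
by have [] := psi_itv (ltW h) (ltW h').
Qed.

Lemma psi_lt x y : x < y -> y <= 1 -> psi x < psi y.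
Proof.
move=> xy y1; rewrite ltNge; apply/negP => /sigma_nd.
by rewrite !sigma_psi// ?leNgt ?xy//; lra.
Qed.

Lemma psi_nd : {homo psi : x y / x <= y}.
Proof.
move=> x y; rewrite le_eqVlt => /predU1P[->//|xy].
have [y1|y1] := leP y 1; first by rewrite ltW// psi_lt.
by rewrite (psi_out1 (ltW y1)) psi_le0.
Qed.

(** Monotonicity and surjectivity stand in for continuity at the end points: near 0 the bound
    [S w <= 1 = S 0] is enough, and near -1 surjectivity provides [w] with [S w] within
    [e / (z - y)] of -1. *)
Lemma chord_closed x y z : -1 <= x -> x < y -> y < z -> z <= 0 ->
  (S y - S x) * (z - y) <= (S z - S y) * (y - x).
Proof.
have half x' y' z' : -1 < x' -> x' < y' -> y' < z' -> z' <= 0 ->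
    (S y' - S x') * (z' - y') <= (S z' - S y') * (y' - x').
  move=> x1 xy yz; rewrite le_eqVlt => /predU1P[z0|]; last exact: chord.
  rewrite {}z0 in yz *; rewrite cusp_end sub0r.
  have Sxy := incr' (ltW x1) xy (ltW yz).
  apply/ler_addgt0Pr => e e0.
  pose w := Num.max (y' / 2) (- (e / (S y' - S x'))).
  have w0 : w < 0 by rewrite gt_max oppr_lt0 divr_gt0 ?subr_gt0// andbT; lra.
  have yw : y' < w by rewrite lt_max; apply/orP; left; lra.
  have we : - (e / (S y' - S x')) <= w by rewrite le_max lexx orbT.
  have h := chord x1 xy yw w0.
  have Sw : S w <= 1 by have /andP[] := @range w (ltW (lt_trans (lt_trans x1 xy) yw)) (ltW w0).
  have h2 : (S w - S y') * (y' - x') <= (1 - S y') * (y' - x').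
    by apply: ler_wpM2r; lra.
  have h3 : (S y' - S x') * - w <= e.
    by rewrite mulrC -ler_pdivlMr ?subr_gt0//; lra.
  lra.
rewrite le_eqVlt => /predU1P[<-|x1]; last exact: half.
rewrite left_end => xy yz z0.
apply/ler_addgt0Pr => e e0.
have [||w [w1 w0 Sw]] := @pre (-1 + Num.min 1 (e / (z - y))).
- by rewrite lerDl le_min ler01 divr_ge0 ?subr_ge0 ?ltW.
- have : Num.min 1 (e / (z - y)) <= 1 by rewrite ge_min lexx.
  by lra.
have m0 : 0 < Num.min 1 (e / (z - y)) by rewrite lt_min ltr01 divr_gt0// subr_gt0.
have m1 : Num.min 1 (e / (z - y)) <= e / (z - y) by rewrite ge_min lexx orbT.
have w1' : -1 < w.
  rewrite lt_neqAle w1 andbT; apply/eqP => wE; move: Sw; rewrite -wE left_end; lra.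
pose v := Num.min w ((-1 + y) / 2).
have v1 : -1 < v by rewrite lt_min w1'/=; lra.
have vy : v < y by rewrite gt_min; apply/orP; right; lra.
have vw : v <= w by rewrite ge_min lexx.
have Sv := nd (ltW v1) vw w0.
have h := half _ _ _ v1 vy yz z0.
have Syz := incr' (ltW (lt_trans v1 vy)) yz z0.
have h1 : (S z - S y) * (y - v) <= (S z - S y) * (y - -1).
  by apply: ler_wpM2l; lra.
have h2 : (S y - (-1) - e / (z - y)) * (z - y) <= (S y - S v) * (z - y).
  by apply: ler_wpM2r; lra.
have h3 : e / (z - y) * (z - y) = e by rewrite divfK// subr_eq0 gt_eqF.
lra.
Qed.

(** By convexity the slope of the chord from -1 to [y] increases with [y], and it already exceeds 1
    for points arbitrarily close to -1. *)
Lemma above_diag y : -1 < y -> y <= 0 -> y < S y.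
Proof.
move=> y1 y0; have d0 : 0 < y + 1 by lra.
have [z [z1 zy z0 Sz]] := above d0.
have zy' : z < y by lra.
have := chord_closed (lexx _) z1 zy' y0; rewrite left_end.
nra.
Qed.

Lemma psi_lt_id x : -1 < x -> psi x < x.
Proof.
move=> x1; have [x2|x2] := leP x 1; last by have := psi_le0 x; lra.
have [z1 z0 Sz] := psi_itv (ltW x1) x2.
rewrite -{2}Sz; apply: above_diag => //.
rewrite lt_neqAle z1 andbT; apply/eqP => h; move: Sz; rewrite -h left_end; lra.
Qed.

Let concave_in x y z : -1 <= x -> x < y -> y < z -> z <= 1 ->
  (y - x) * (psi z - psi y) <= (z - y) * (psi y - psi x).
Proof.
move=> x1 xy yz z1.
have [a1 a0 Sa] := @psi_itv x x1 (ltac:(lra)).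
have [b1 b0 Sb] := @psi_itv y (ltac:(lra)) (ltac:(lra)).
have [c1 c0 Sc] := @psi_itv z (ltac:(lra)) z1.
have := chord_closed a1 (psi_lt xy (ltac:(lra))) (psi_lt yz z1) c0.
by rewrite Sa Sb Sc.
Qed.

(** By concavity a chord inside [-1, 1] is at most as steep as the chord from -1 to its left end,
    whose slope is less than 1 because [psi] lies below the diagonal. *)
Lemma psi_lip x y : x <= y -> psi y - psi x <= y - x.
Proof.
rewrite le_eqVlt => /predU1P[->|xy]; first by rewrite !subrr.
have [x1|x1] := leP x (-1).
  rewrite (psi_out x1); have [y1|y1] := leP y (-1); first by rewrite psi_out.
  by have := psi_lt_id y1; lra.
have mid z : z <= 1 -> x < z -> psi z - psi x <= z - x.
  move=> z1 xz; have := concave_in (lexx _) x1 xz z1.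
  rewrite (psi_out (lexx _)) => h; have px := psi_lt_id x1.
  have h2 : (z - x) * (psi x - -1) <= (z - x) * (x - -1) by apply: ler_wpM2l; lra.
  have x10 : 0 < x - -1 by lra.
  by rewrite -(ler_pM2l x10); lra.
have [y1|y1] := leP y 1; first exact: mid.
rewrite (psi_out1 (ltW y1)); have [x2|x2] := leP 1 x; first by rewrite psi_out1//; lra.
by have := mid 1 (lexx _) x2; rewrite psi_out1//; lra.
Qed.

Lemma psi_concave x y z : x < y -> y < z ->
  (y - x) * (psi z - psi y) <= (z - y) * (psi y - psi x).
Proof.
move=> xy yz; have [y1|y1] := leP y (-1).
  have x1 : x <= -1 by lra.
  rewrite (psi_out y1) (psi_out x1).
  rewrite mulrC; apply: ler_wpM2r; first lra.
  by have := psi_lip (ltW yz); rewrite (psi_out y1).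
have [y2|y2] := leP 1 y.
  have z1 : 1 <= z by lra.
  rewrite (psi_out1 y2) (psi_out1 z1).
  rewrite subrr mulr0 mulr_ge0//; first lra.
  by rewrite subr_ge0 psi_le0.
(* With [y] strictly inside (-1, 1) only [x] and [z] need projecting. The pieces cut off have slope
   1 on the left, the largest possible by [psi_lip], and 0 on the right, the smallest possible. *)
pose x' := Num.max x (-1); pose z' := Num.min z 1.
have zE : psi z' = psi z.
  rewrite /z'; case: (leP z 1) => // h; rewrite psi_out1// psi_out1//; exact: ltW.
have zz : z' <= z by rewrite ge_min lexx.
have yz' : y < z' by rewrite lt_min yz.
have z1 : z' <= 1 by rewrite ge_min lexx orbT.
have x'1 : -1 <= x' by rewrite le_max lexx orbT.
have x'y : x' < y by rewrite gt_max xy.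
have h := concave_in x'1 x'y yz' z1; rewrite zE in h.
have xE : psi x = psi x' - (x' - x).
  rewrite /x'; case: (leP x (-1)) => h'; last by lra.
  by rewrite psi_out// psi_out//; lra.
have xx : x <= x' by rewrite le_max lexx.
have l1 := psi_lip (ltW yz).
have m1 := psi_nd (ltW xy); have m2 := psi_nd (ltW x'y).
have h1 : (z' - y) * (psi y - psi x') <= (z - y) * (psi y - psi x').
  by apply: ler_wpM2r; lra.
have h2 : (x' - x) * (psi z - psi y) <= (x' - x) * (z - y).
  by apply: ler_wpM2l; lra.
rewrite xE; lra.
Qed.

(** For a concave function the infimum of the slopes of chords ending at [x] is the left derivative;
    defined this way it needs no limit. *)
Definition slope_of x := inf [set (psi x - psi t) / (x - t) | t in [set t | t < x]].
Local Notation D := slope_of.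

Let slope_lb x : has_lbound [set (psi x - psi t) / (x - t) | t in [set t | t < x]].
Proof.
exists 0 => _ [t /= tx <-]; rewrite divr_ge0 ?subr_ge0 ?(ltW tx)// psi_nd//; exact: ltW.
Qed.

Lemma slope_of_ge x y : x <= y -> D y * (y - x) <= psi y - psi x.
Proof.
rewrite le_eqVlt => /predU1P[->|xy]; first by rewrite !subrr mulr0.
rewrite -ler_pdivlMr ?subr_gt0//; apply: ge_inf => //.
by exists x.
Qed.

Lemma slope_of_le x y : x <= y -> psi y - psi x <= D x * (y - x).
Proof.
rewrite le_eqVlt => /predU1P[->|xy]; first by rewrite !subrr mulr0.
rewrite -ler_pdivrMr ?subr_gt0//; apply: lb_le_inf.
  by exists ((psi x - psi (x - 1)) / (x - (x - 1))), (x - 1) => //=; lra.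
move=> _ [t /= tx <-]; rewrite ler_pdivrMr ?subr_gt0// mulrAC ler_pdivlMr ?subr_gt0//.
by have := psi_concave tx xy; lra.
Qed.

Lemma slope_of_ge0 x : 0 <= D x.
Proof.
have h : x <= x + 1 by lra.
have := slope_of_le h; have := psi_nd h; rewrite addrAC subrr add0r mulr1; lra.
Qed.

Lemma slope_of_le1 x : D x <= 1.
Proof.
have h : x - 1 <= x by lra.
have := slope_of_ge h; have := psi_lip h.
rewrite (_ : x - (x - 1) = 1) ?mulr1; last by ring.
lra.
Qed.

Lemma slope_of_small e : 0 < e -> exists t, -1 < t < 1 /\ D t <= e.
Proof.
move=> e0; have e20 : 0 < e / 2 by lra.
have [y [y1 y0 hy]] := cusp e20.
have Sy1 : S y < 1 by rewrite -cusp_end incr'// ltW.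
have Sy0 : -1 < S y by rewrite -left_end incr'// ltW.
(* At the midpoint [t], the slope is at most that of the chord from [S y], hence at most [- y]
   divided by [(1 - S y) / 2]; this is why [cusp] is used with [e / 2]. *)
pose t := (S y + 1) / 2.
have st : S y <= t by rewrite /t; lra.
exists t; split; first by rewrite /t; lra.
have h := slope_of_ge st.
have psiy : psi (S y) = y by rewrite -(sigma_in (ltW y1) (ltW y0)) psi_sigma// ltW.
have p0 := psi_le0 t.
have tE : t - S y = (1 - S y) / 2 by rewrite /t; field.
rewrite psiy tE in h.
have : D t * ((1 - S y) / 2) <= e * ((1 - S y) / 2) by lra.
by rewrite ler_pM2r//; lra.
Qed.

Lemma slope_of_1 x : 1 <= x -> D x = 0.
Proof.
move=> x1; apply/eqP; rewrite eq_le slope_of_ge0 andbT.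
apply/ler_addgt0Pr => e /slope_of_small[t [/andP[_ t1] h]]; rewrite add0r.
apply: le_trans h; have tx : t < x by lra.
by rewrite -(@ler_pM2r _ (x - t)) ?subr_gt0// (le_trans (slope_of_ge _) (slope_of_le _))// ltW.
Qed.

Lemma build_branch : cusp_branch sigma psi D.
Proof.
split.
- exact: sigma_nd.
- exact: psi_sigma.
- exact: sigma_psi.
- exact: psi_le0.
- exact: psi_out.
- exact: psi_out1.
- exact: psi_lt_id.
- exact: slope_of_ge0.
- exact: slope_of_le1.
- exact: slope_of_1.
- exact: slope_of_small.
- exact: slope_of_ge.
- exact: slope_of_le.
Qed.

End build_branch.

(** * Orders of magnitude of the slope at both ends *)

Section asymptotics.
Context (R : realType).

(** Only orders of magnitude matter from here on, so an equivalence is weakened to bounds up to a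
    factor 2. *)
Lemma equiv_bounds (F : filter_on R) (f g : R -> R) : (forall x, 0 <= g x) ->
  f ~_F g -> \forall x \near F, g x / 2 <= f x <= 2 * g x.
Proof.
move=> g0 /eqaddoP h; have h2 : 0 < 2^-1 :> R by [].
apply: filterS (h _ h2) => x; rewrite (ger0_norm (g0 x)) ler_norml /= => /andP[].
rewrite -[(f - g) x]/(f x - g x) => a b; have := g0 x => c.
by apply/andP; split; lra.
Qed.

Lemma near_dnbhs0 (P : R -> Prop) : (\forall x \near 0^', P x) ->
  exists d : R, 0 < d /\ forall x, 0 < `|x| -> `|x| < d -> P x.
Proof.
move=> /nbhs_ballP[d /= d0 H]; exists d; split => // x x0 xd.
by apply: H; rewrite /ball/= ?sub0r ?normrN// -normr_gt0.
Qed.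

Lemma near_right (p : R) (P : R -> Prop) : (\forall x \near p^'+, P x) ->
  exists d : R, 0 < d /\ forall x, p < x -> x < p + d -> P x.
Proof.
move=> /nbhs_ballP[d /= d0 H]; exists d; split => // x x0 xd.
by apply: H => //; rewrite /ball/= ltr_norml; lra.
Qed.

Lemma powR_small (p e : R) : 0 < p -> 0 < e ->
  exists d : R, 0 < d /\ forall x, 0 < x -> x < d -> x `^ p < e.
Proof.
move=> p0 e0; have /cvgrPdist_lt /(_ e e0) /near_right[d [d0 H]] := powR_cvg0 p0.
exists d; split => // x x0 xd; have := H x x0; rewrite add0r => /(_ xd).
by rewrite sub0r normrN ger0_norm ?powR_ge0.
Qed.

Lemma powR_sub1 (x p : R) : 0 < x -> 0 < p -> x `^ p / x = x `^ (p - 1).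
Proof.
move=> x0 p0; rewrite -(mulr_powRB1 (ltW x0) p0) mulrC mulrA mulVf ?mul1r//.
by rewrite gt_eqF.
Qed.

Lemma powR_le (x y p : R) : 0 <= p -> 0 <= x -> x <= y -> x `^ p <= y `^ p.
Proof.
move=> p0 x0 xy; apply: ge0_ler_powR => //; rewrite nnegrE//.
exact: le_trans xy.
Qed.

Lemma powR_inv (x p : R) : 0 < p -> 0 <= x -> (x `^ p) `^ (p^-1) = x.
Proof. by move=> p0 x0; rewrite -powRrM mulfV ?gt_eqF// powRr1. Qed.

Variables (sigma psi D : R -> R).
Hypothesis br : cusp_branch sigma psi D.

Lemma inv_asymptotics (kappa b d : R) : 0 < kappa -> 0 < b -> 0 < d ->
  (forall y, - d < y -> y < 0 -> -1 <= y ->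
    b * (- y) `^ kappa / 2 <= 1 - sigma y <= 2 * (b * (- y) `^ kappa)) ->
  exists m1 m2 t0 : R, [/\ 0 < m1, 0 < m2, 0 < t0, t0 < 1 &
    forall t, 0 < t -> t < t0 ->
      m1 * t `^ kappa^-1 <= - psi (1 - t) <= m2 * t `^ kappa^-1].
Proof.
move=> k0 b0 d0 H.
pose d1 := Num.min d (1 / 2).
have d10 : 0 < d1 by rewrite lt_min d0/=; lra.
have d1d : d1 <= d by rewrite ge_min lexx.
have d12 : d1 <= 1 / 2 by rewrite ge_min lexx orbT.
have nd0 : - d1 <= 0 by lra.
have sd1 : sigma (- d1) < 1.
  by rewrite -(lt_branch_inv br nd0 (lexx _)) (branch_inv_1 br (lexx _)); lra.
exists ((2 * b)^-1 `^ kappa^-1), ((2 / b) `^ kappa^-1), (Num.min (1 - sigma (- d1)) (1 / 2)).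
have ki : 0 <= kappa^-1 by rewrite invr_ge0 ltW.
split.
- by rewrite powR_gt0// invr_gt0 mulr_gt0.
- by rewrite powR_gt0// divr_gt0.
- by rewrite lt_min subr_gt0 sd1/=; lra.
- by rewrite gt_min; apply/orP; right; lra.
move=> t t0; rewrite lt_min => /andP[t1 t2].
have x1 : 1 - t <= 1 by lra.
have x1' : 1 - t < 1 by lra.
have py : - d1 < psi (1 - t) by rewrite (lt_branch_inv br)//; lra.
have p0 : psi (1 - t) < 0.
  rewrite lt_neqAle (branch_inv_le0 br) andbT; apply/eqP => h; have := x1'.
  by rewrite -{1}(branch_invK br x1) h (branch0 br) ltxx.
have := H (psi (1 - t)); rewrite (branch_invK br x1).
set w := - psi (1 - t).
have w0 : 0 < w by rewrite oppr_gt0.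
have -> : 1 - (1 - t) = t by ring.
move=> /(_ (ltac:(lra)) p0 (ltac:(lra))) /andP[h1 h2].
have wk : (w `^ kappa) `^ kappa^-1 = w by rewrite powR_inv// ltW.
rewrite -!powRM ?(ltW t0) ?invr_ge0 ?divr_ge0 ?mulr_ge0 ?(ltW b0)//.
rewrite -[X in _ <= X <= _]wk; apply/andP; split; apply: powR_le => //.
- by rewrite mulr_ge0 ?invr_ge0 ?mulr_ge0 ?(ltW t0) ?(ltW b0).
- by rewrite mulrC ler_pdivrMr ?mulr_gt0//; lra.
- exact: powR_ge0.
- by rewrite mulrAC ler_pdivlMr//; lra.
Qed.

(** Concavity allows the asymptotics of [psi] to be differentiated up to constants: the chord over
    [[1 - t, 1]] bounds [D (1 - t)] from below, the chord over [[1 - 2 * t, 1 - t]] from above. The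
    latter needs the estimate at [2 * t], hence the halved range. *)
Lemma slope_asymptotics_1 (kappa b d : R) : 0 < kappa -> 0 < b -> 0 < d ->
  (forall y, - d < y -> y < 0 -> -1 <= y ->
    b * (- y) `^ kappa / 2 <= 1 - sigma y <= 2 * (b * (- y) `^ kappa)) ->
  exists k1 k2 t0 : R, [/\ 0 < k1, 0 < k2, 0 < t0, t0 < 1 &
    forall t, 0 < t -> t < t0 ->
      k1 * t `^ (kappa^-1 - 1) <= D (1 - t) <= k2 * t `^ (kappa^-1 - 1)].
Proof.
move=> k0 b0 d0 H; have [m1 [m2 [t0 [m10 m20 t00 t01 Hp]]]] := inv_asymptotics k0 b0 d0 H.
have ki : 0 < kappa^-1 by rewrite invr_gt0.
exists m1, (m2 * 2 `^ kappa^-1), (t0 / 2); split => //; try lra.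
  by rewrite mulr_gt0// powR_gt0.
move=> t t1 t2; rewrite -powR_sub1//; apply/andP; split.
- have h : 1 - t <= 1 by lra.
  have := chord_le br h; rewrite (branch_inv_1 br (lexx _)).
  have /andP[h1 _] := Hp t t1 (ltac:(lra)).
  by rewrite mulrA ler_pdivrMr//; lra.
- have h : 1 - 2 * t <= 1 - t by lra.
  have := chord_ge br h; have := branch_inv_le0 br (1 - t).
  have t20 : 0 < 2 * t by lra.
  have /andP[_] := Hp (2 * t) t20 (ltac:(lra)).
  rewrite powRM ?(ltW t1)// => h1 h2 h3.
  by rewrite mulrA ler_pdivlMr//; lra.
Qed.

(** The same device applied to the defect [1 - D], with the chords over [[-1, -1 + v]] and
    [[-1 + v, -1 + 2 * v]]. *)
Lemma slope_asymptotics_N1 (gamma a d : R) : 1 < gamma -> 0 < a -> 0 < d ->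
  (forall y, -1 < y -> y < -1 + d -> y <= 0 ->
    a * (y + 1) `^ gamma / 2 <= sigma y - y <= 2 * (a * (y + 1) `^ gamma)) ->
  exists l1 l2 v0 : R, [/\ 0 < l1, 0 < l2, 0 < v0, v0 < 1 &
    forall v, 0 < v -> v < v0 ->
      l1 * v `^ (gamma - 1) <= 1 - D (-1 + v) <= l2 * v `^ (gamma - 1) /\
      v / 2 <= 1 + psi (-1 + v) <= v].
Proof.
move=> g1 a0 d0 H; have g0 : 0 < gamma by lra.
have g10 : 0 < gamma - 1 by lra.
have a20 : 0 < (2 * a)^-1 by rewrite invr_gt0 mulr_gt0.
(* Below [v1] the defect satisfies [v - w <= w], which gives [v / 2 <= w] and lets powers of [w] be
   replaced by powers of [v]. *)
have [v1 [v10 Hv1]] := powR_small g10 a20.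
pose v0 := Num.min v1 (Num.min d 1) / 2.
have hv0 : 0 < Num.min v1 (Num.min d 1) by rewrite !lt_min v10 d0 ltr01.
have hv1 : Num.min v1 (Num.min d 1) <= v1 by rewrite ge_min lexx.
have hvd : Num.min v1 (Num.min d 1) <= d by rewrite !ge_min lexx orbT.
have hv2 : Num.min v1 (Num.min d 1) <= 1 by rewrite !ge_min lexx !orbT.
have diff v : 0 < v -> v < 2 * v0 ->
   let w := 1 + psi (-1 + v) in
   [/\ 0 < w, w <= v & a * w `^ gamma / 2 <= v - w <= 2 * (a * w `^ gamma)].
  rewrite /v0 => vp vv /=; set w := 1 + psi (-1 + v); have x1 : -1 < -1 + v by lra.
  have x2 : -1 + v <= 1 by lra.
  have pw : psi (-1 + v) = w - 1 by rewrite /w; ring.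
  have p1 : -1 < psi (-1 + v) by rewrite (lt_branch_inv br) ?(branchN1 br)//; lra.
  have p2 := branch_inv_le br (-1 + v).
  have p3 := branch_inv_le0 br (-1 + v).
  have := H (psi (-1 + v)) p1 (ltac:(lra)) p3.
  rewrite (branch_invK br x2) pw subrK => h; rewrite (_ : v - w = -1 + v - (w - 1)); last by ring.
  by split => //; lra.
exists (a / 2 * (1 / 2) `^ gamma), (2 * a * 2 `^ gamma), v0.
have v0E : 2 * v0 = Num.min v1 (Num.min d 1) by rewrite /v0; field.
split.
- by rewrite mulr_gt0 ?divr_gt0// powR_gt0//; lra.
- by rewrite !mulr_gt0// powR_gt0.
- by rewrite /v0; lra.
- by rewrite /v0; lra.
move=> v vp vv.
have [w0 wv /andP[e1 e2]] := diff v vp (ltac:(lra)); move: w0 wv e1 e2.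
set w := 1 + psi (-1 + v) => w0 wv e1 e2.
have wg : w `^ gamma <= w * v `^ (gamma - 1).
  rewrite -(mulr_powRB1 (ltW w0) g0); apply: ler_wpM2l; first exact: ltW.
  by apply: powR_le => //; exact: ltW.
have vg := Hv1 v vp (ltac:(lra)).
have half : v / 2 <= w.
  have : 2 * a * v `^ (gamma - 1) <= 1.
    by rewrite mulrC -ler_pdivlMr ?mulr_gt0// mul1r ltW.
  move=> h; have : w * (2 * a * v `^ (gamma - 1)) <= w * 1 by apply: ler_wpM2l => //; exact: ltW.
  have : a * w `^ gamma <= a * (w * v `^ (gamma - 1)) by apply: ler_wpM2l => //; exact: ltW.
  lra.
have pN1 := branch_inv_N1 br (lexx (-1)).
split; last by rewrite half wv.
rewrite -powR_sub1//; apply/andP; split.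
- have h : -1 <= -1 + v by lra.
  have := chord_ge br h; rewrite pN1 (_ : psi (-1 + v) = w - 1); last by rewrite /w; ring.
  rewrite mulrA ler_pdivrMr// => h2.
  have : (v / 2) `^ gamma <= w `^ gamma.
    by apply: powR_le => //; lra.
  rewrite (_ : v / 2 = 1 / 2 * v); last by field.
  have -> : (1 / 2 * v) `^ gamma = (1 / 2) `^ gamma * v `^ gamma by apply: powRM; lra.
  move=> h3; have : a / 2 * ((1 / 2) `^ gamma * v `^ gamma) <= a / 2 * w `^ gamma.
    by apply: ler_wpM2l => //; lra.
  lra.
- have h : -1 + v <= -1 + 2 * v by lra.
  have := chord_le br h.
  have v20 : 0 < 2 * v by lra.
  have [w0' wv' /andP[e1' e2']] := diff (2 * v) v20 (ltac:(lra)); move: w0' wv' e1' e2'.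
  rewrite (_ : psi (-1 + v) = w - 1); last by rewrite /w; ring.
  set w' := 1 + psi (-1 + 2 * v) => w0' wv' e1' e2'.
  rewrite (_ : psi (-1 + 2 * v) = w' - 1); last by rewrite /w'; ring.
  rewrite mulrA ler_pdivlMr// => h2.
  have : w' `^ gamma <= (2 * v) `^ gamma.
    by apply: powR_le => //; exact: ltW.
  rewrite powRM ?(ltW vp)// => h3.
  have : 2 * a * w' `^ gamma <= 2 * a * (2 `^ gamma * v `^ gamma).
    by apply: ler_wpM2l => //; lra.
  lra.
Qed.

End asymptotics.

(** * Approximation of the density by step functions with a control *)

Section step_functions.
Context (R : realType).
Notation lam := (@lebesgue_measure R).
Let E : set (measurableTypeR R) := `[-1, 1]%classic.
Let mE : measurable E. Proof. exact: measurable_itv. Qed.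

(** Composing with this projection makes the step functions constant outside [-1, 1], so that their
    controls vanish to the right of 1. *)
Definition clamp (x : R) := Num.max (-1) (Num.min x 1).
Definition cell (n : nat) (x : R) : int := Num.floor (clamp x * n.+1%:R).
Definition grid (n : nat) (x : R) : R := (cell n x)%:~R / n.+1%:R.

Lemma clamp_itv x : -1 <= clamp x <= 1.
Proof. by rewrite /clamp le_max lexx/= ge_max ge_min lexx orbT andbT; lra. Qed.

Lemma clamp_nd : {homo clamp : x y / x <= y}.
Proof.
move=> x y xy; rewrite /clamp ge_max !le_max lexx/=; apply/orP; right.
by rewrite le_min !ge_min lexx orbT andbT xy.
Qed.

Lemma clamp_id x : -1 <= x <= 1 -> clamp x = x.
Proof. by move=> /andP[x1 x2]; rewrite /clamp min_l// max_r. Qed.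

Lemma cell_nd n : {homo cell n : x y / x <= y}.
Proof. by move=> x y xy; apply: le_floor; rewrite ler_pM2r ?ltr0n// clamp_nd. Qed.

Lemma cell_itv n x : - n.+1%:R <= (cell n x)%:~R :> R /\
  (cell n x)%:~R <= n.+1%:R :> R.
Proof.
have /andP[c1 c2] := clamp_itv x; have n0 : 0 < n.+1%:R :> R by rewrite ltr0n.
split; last first.
  by apply: le_trans (floor_le _) _; rewrite -[leRHS]mul1r ler_wpM2r// ltW.
have -> : - n.+1%:R = (- n.+1%:Z)%:~R :> R by rewrite rmorphN.
rewrite ler_int /cell floor_ge_int rmorphN /=.
by have := ler_wpM2r (ltW n0) c1; rewrite mulN1r.
Qed.

Lemma grid_itv n x : -1 <= grid n x <= 1.
Proof.
have [c1 c2] := cell_itv n x; have n0 : 0 < n.+1%:R :> R by rewrite ltr0n.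
by rewrite /grid ler_pdivlMr// ler_pdivrMr// mulN1r mul1r c1.
Qed.

Lemma grid_near n x : -1 <= x <= 1 -> `|x - grid n x| <= n.+1%:R^-1.
Proof.
move=> x1; have n0 : 0 < n.+1%:R :> R by rewrite ltr0n.
have := floor_itv (clamp x * n.+1%:R); rewrite clamp_id// -/(cell n x) intrD => /andP[h1 h2].
rewrite /grid -(@ler_pM2r _ n.+1%:R)// mulVf ?gt_eqF//.
rewrite -{2}[n.+1%:R]ger0_norm ?(ltW n0)// -normrM mulrBl divfK ?gt_eqF//.
have -> : cell n x = Num.floor (x * n.+1%:R) by rewrite /cell clamp_id.
by rewrite ger0_norm; lra.
Qed.

Lemma measurable_grid n (A : set R) : measurable A -> measurable_fun A (grid n).
Proof.
move=> mA; apply: nondecreasing_measurable => // x y xy; rewrite /grid ler_pM2r ?invr_gt0//.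
by rewrite ler_int cell_nd.
Qed.

(** Taking the positive part does not increase the distance to the nonnegative function [rho]. *)
Definition step_fun (g : R -> R) n x := Num.max (g (grid n x)) 0.
(** Counts the grid steps left before 1: a step function with values in [0, M] jumps by at most [M]
    at each. This control grows with [n], but only the control reached after the descent has to be
    bounded. *)
Definition step_control (M : R) n x := M * (n.+1%:R - (cell n x)%:~R).

Lemma step_controls (g : R -> R) M n : (forall x, -1 <= x <= 1 -> `|g x| <= M) ->
  controls (step_control M n) (step_fun g n).
Proof.
move=> gM x y xy; have M0 : 0 <= M by apply: le_trans (gM 0 _); rewrite ?normr_ge0//; lra.
have -> : step_control M n x - step_control M n y = M * ((cell n y)%:~R - (cell n x)%:~R).
  by rewrite /step_control; ring.
have := cell_nd n xy; rewrite le_eqVlt => /predU1P[h|h].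
  by rewrite /step_fun /grid h !subrr normr0 mulr0.
have h1 : 1 <= (cell n y)%:~R - (cell n x)%:~R :> R.
  by rewrite -intrB -[1]/(1%:~R) ler_int lerBrDl lezD1.
have := gM _ (grid_itv n x); have := gM _ (grid_itv n y); rewrite /step_fun.
rewrite !ler_norml => /andP[a1 a2] /andP[b1 b2].
have a : 0 <= Num.max (g (grid n y)) 0 <= M by rewrite le_max lexx orbT ge_max a2 M0.
have b : 0 <= Num.max (g (grid n x)) 0 <= M by rewrite le_max lexx orbT ge_max b2 M0.
have MM : M * 1 <= M * ((cell n y)%:~R - (cell n x)%:~R) by apply: ler_wpM2l.
case/andP: a => a3 a4; case/andP: b => b3 b4.
by apply/andP; split; lra.
Qed.

Lemma step_control_eq0 M n x : 1 <= x -> step_control M n x = 0.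
Proof.
move=> x1; rewrite /step_control /cell /clamp min_r// max_r; last by lra.
by rewrite mul1r -[X in Num.floor X]/(n.+1%:Z%:~R) intrKfloor subrr mulr0.
Qed.

Variables (mu : {measure set (measurableTypeR R) -> \bar R}) (rho : R -> R).
Hypotheses (mrho : measurable_fun setT rho) (rho0 : forall x, 0 <= rho x)
  (muE : mu E = 1%E)
  (mu_rho : forall A : set (measurableTypeR R), measurable A ->
     mu A = (\int[lam]_(x in A) (rho x)%:E)%E).

(** [rho] is approximated in L1 by a continuous function, and the latter by its values on a grid; an
    L1 error bounds the error on all sets [B] at once. *)
Lemma mu_approx (e : R) : 0 < e -> exists f u, admissible mu f u e.
Proof.
move=> e0.
have irho : lam.-integrable E (EFin \o rho).
  apply/integrableP; split; first by apply/measurable_EFinP; exact: measurable_funTS.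
  under eq_integral do rewrite /= ger0_norm//.
  by rewrite -mu_rho// muE ltry.
have lE : (lam E < +oo)%E.
  by rewrite lebesgue_measure_itv/= lte_fin; case: ifP => // _; rewrite -EFinD ltry.
have [g_ [cg ig cvg]] := approximation_continuous_integrable mE lE irho.
have e20 : 0 < e / 2 by lra.
have [g [cg' mg' hg]] : exists g : R -> R, [/\ continuous g, measurable_fun [set: R] g &
    (\int[lam]_(x in E) `|(rho x - g x)%:E| < (e / 2)%:E)%E].
  move: cvg => /fine_cvgP[fcvg /cvgrPdist_lt /(_ _ e20) ecvg].
  have [n [fn hn]] : exists n, (\int[lam]_(x in E) `|(rho x - g_ n x)%:E|)%E \is a fin_num /\
      `|0 - fine (\int[lam]_(x in E) `|(rho x - g_ n x)%:E|)%E| < e / 2.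
    by near \oo => n; exists n; split; near: n.
  exists (g_ n); split => //; first exact: continuous_measurable_fun.
  rewrite -(fineK fn) lte_fin; apply: le_lt_trans hn.
  by rewrite sub0r normrN ler_norm.
have [M gM] : exists M, forall x, -1 <= x <= 1 -> `|g x| <= M.
  have ng : {within `[-1, 1]%classic, continuous (fun x : R => `|g x|)}.
    apply: continuous_subspaceT => x; apply: continuous_comp; first exact: cg'.
    exact: norm_continuous.
  have N11 : (-1 : R) <= 1 by lra.
  have [c _ H] := EVT_max N11 ng.
  by exists `|g c| => x x1; apply: H; rewrite in_itv.
have [n hn] : exists n, (\int[lam]_(x in E) `|(g (grid n x) - g x)%:E| < (e / 2)%:E)%E.
  have [] := @dominated_convergence _ _ _ lam E mE
    (fun n x => (g (grid n x))%:E) (EFin \o g) (cst M%:E).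
  - by move=> n; apply/measurable_EFinP; apply: (measurableT_comp mg'); exact: measurable_grid.
  - by apply/measurable_EFinP; exact: measurable_funTS.
  - apply: aeW => x; rewrite /E/= in_itv/= => x1.
    apply: cvg_EFin; first by near=> n.
    apply: (@cvg_comp _ _ _ (fun n => grid n x) g _ (nbhs x)) => //; last exact: cg'.
    apply/cvgrPdist_le => d d0; have := @cvg_harmonic R.
    move=> /cvgrPdist_le /(_ d d0); apply: filterS => n; rewrite /= sub0r normrN.
    rewrite ger0_norm ?invr_ge0//; apply: le_trans; exact: grid_near.
  - apply/integrableP; split => //; under eq_integral do rewrite /=.
    rewrite integral_cst//; apply: lte_mul_pinfty => //.
  - by apply: aeW => x n _ /=; rewrite lee_fin gM ?grid_itv.
  move=> _ /fine_cvgP[fcvg /cvgrPdist_lt /(_ _ e20) ecvg] _.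
  have [n [fn hn]] : exists n,
      (\int[lam]_(x in E) `|(g (grid n x))%:E - (g x)%:E|)%E \is a fin_num /\
      `|0 - fine (\int[lam]_(x in E) `|(g (grid n x))%:E - (g x)%:E|)%E| < e / 2.
    by near \oo => n; exists n; split; near: n.
  exists n; under eq_integral do rewrite EFinB.
  rewrite -(fineK fn) lte_fin; apply: le_lt_trans hn.
  by rewrite sub0r normrN ler_norm.
exists (step_fun g n), (step_control M n).
have ctl := step_controls n gM.
have mf : measurable_fun [set: R] (step_fun g n) by exact: (measurable_controlled ctl).
split => //.
- by move=> x; rewrite /step_fun le_max lexx orbT.
- exact: step_control_eq0.
have mdist (h k : R -> R) (A : set (measurableTypeR R)) : measurable_fun [set: R] h ->
    measurable_fun [set: R] k -> measurable A -> measurable_fun A (fun x => `|(h x - k x)%:E|)%E.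
  move=> mh mk mA; apply: measurableT_comp => //; apply/measurable_EFinP.
  by apply: measurable_funB; exact: measurable_funTS.
have mgrid : measurable_fun [set: R] (g \o grid n).
  by apply: (measurableT_comp mg'); exact: measurable_grid.
have dist : (\int[lam]_(x in E) `|(rho x - step_fun g n x)%:E| <= e%:E)%E.
  have -> : e%:E = ((e / 2)%:E + (e / 2)%:E)%E by rewrite -EFinD; congr EFin; field.
  apply: le_trans (leeD (ltW hg) (ltW hn)).
  rewrite -ge0_integralD//; last 2 first.
  - exact: mdist.
  - exact: (mdist (g \o grid n)).
  apply: ge0_le_integral => //.
  - exact: mdist.
  - by apply: emeasurable_funD; [exact: mdist|exact: (mdist (g \o grid n))].
  - move=> x _; rewrite -EFinD lee_fin /step_fun.
    rewrite (distrC (g _)) addrC -[X in _ <= `|X| + _]opprB normrN.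
    have := rho0 x; have := ler_norm (rho x - g x); have := ler_norm (g x - rho x).
    have := ler_norm (g x - g (grid n x)); have := ler_norm (g (grid n x) - g x).
    rewrite (distrC (g x) (rho x)) (distrC (g (grid n x)) (g x)).
    case: (leP (g (grid n x)) 0) => h; rewrite ler_norml => *; apply/andP; split; lra.
move=> B mB BO.
have BE : B `<=` E.
  by move=> x /BO; rewrite /E/= !in_itv/= => /andP[]; lra.
have distB : (\int[lam]_(x in B) `|(rho x - step_fun g n x)%:E| <= e%:E)%E.
  by apply: le_trans dist; apply: ge0_subset_integral => //; exact: mdist.
have f0 x : 0 <= step_fun g n x by rewrite /step_fun le_max lexx orbT.
have mrB : measurable_fun B (EFin \o rho) by apply/measurable_EFinP; exact: measurable_funTS.
have mfB : measurable_fun B (EFin \o step_fun g n).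
  by apply/measurable_EFinP; exact: measurable_funTS.
have mdB := mdist _ _ B mrho mf mB.
rewrite mu_rho//; split.
- apply: le_trans (leeD2l _ distB); rewrite -ge0_integralD//; last first.
    by move=> x _; rewrite lee_fin.
  apply: ge0_le_integral => //; first by move=> x _; rewrite lee_fin.
    exact: emeasurable_funD.
  move=> x _; rewrite -EFinD lee_fin distrC.
  by have := ler_norm (step_fun g n x - rho x); lra.
- apply: le_trans (leeD2l _ distB); rewrite -ge0_integralD//; last first.
    by move=> x _; rewrite lee_fin.
  apply: ge0_le_integral => //; first by move=> x _; rewrite lee_fin.
    exact: emeasurable_funD.
  move=> x _; rewrite -EFinD lee_fin.
  by have := ler_norm (rho x - step_fun g n x); lra.
Unshelve. all: by end_near.
Qed.

End step_functions.

(** * The neutral point: comparison of two powers *)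

Section neutral_rates.
Context (R : realType) (sigma psi D : R -> R).
Hypothesis br : cusp_branch sigma psi D.
Notation lam := (@lebesgue_measure R).
Variable mu : {measure set (measurableTypeR R) -> \bar R}.
Let O : set (measurableTypeR R) := `]-1, 1[%classic.
Hypothesis mu1 : (mu O = 1)%E.
Hypothesis mu_inv : forall B : set (measurableTypeR R), measurable B -> B `<=` O ->
  mu B = mu (preim_left sigma B `|` preim_right sigma B).
Hypothesis mu_approx : forall e, 0 < e -> exists f u, admissible mu f u e.
(** [p] and [g] stand for [kappa^-1 - 1] and [gamma - 1], the orders of the slope at 1 and of its
    defect at -1. *)
Variables (p g k1 k2 t0 l1 l2 v0 : R).
Hypotheses (p0 : 0 < p) (g0 : 0 < g)
  (k10 : 0 < k1) (k20 : 0 < k2) (t00 : 0 < t0) (l10 : 0 < l1) (l20 : 0 < l2) (v00 : 0 < v0)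
  (D1 : forall t, 0 < t -> t < t0 -> k1 * t `^ p <= D (1 - t) <= k2 * t `^ p)
  (DN1 : forall v, 0 < v -> v < v0 ->
     l1 * v `^ g <= 1 - D (-1 + v) <= l2 * v `^ g /\
     v / 2 <= 1 + psi (-1 + v) <= v).

Let D_opp v : 0 < v -> v < v0 -> v < t0 ->
  k1 * (1 / 2) `^ p * v `^ p <= D (- psi (-1 + v)) <= k2 * v `^ p.
Proof.
move=> v1 v2 v3; have [_ /andP[w1 w2]] := DN1 v1 v2.
set w := 1 + psi (-1 + v) in w1 w2.
have -> : - psi (-1 + v) = 1 - w by rewrite /w; ring.
have /andP[h1 h2] := @D1 w (ltac:(lra)) (ltac:(lra)).
have e1 : (v / 2) `^ p <= w `^ p by apply: (powR_le (ltW p0)); lra.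
have e2 : w `^ p <= v `^ p by apply: (powR_le (ltW p0)); lra.
have e3 : (v / 2) `^ p = (1 / 2) `^ p * v `^ p.
  by rewrite (_ : v / 2 = 1 / 2 * v); [apply: powRM; lra|field].
apply/andP; split.
  by apply: le_trans h1; rewrite -mulrA -e3; apply: ler_wpM2l => //; exact: ltW.
by apply: le_trans h2 _; apply: ler_wpM2l => //; exact: ltW.
Qed.

Let range x1 d : x1 < 1 -> 0 < d -> exists r : R,
  [/\ -1 < r, r < 1, x1 <= - psi r &
   forall x, -1 < x < r -> exists v, [/\ x = -1 + v, 0 < v, v < v0, v < t0 & v < d]].
Proof.
move=> x11 d0; pose m := Num.min (Num.min (1 - x1) 1) (Num.min d (Num.min t0 v0)).
have m0 : 0 < m by rewrite !lt_min d0 t00 v00 ltr01 subr_gt0 x11.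
have m1 : m <= 1 - x1 by rewrite !ge_min lexx.
have m2 : m <= 1 by rewrite !ge_min lexx orbT.
have m3 : m <= d by rewrite !ge_min lexx !orbT.
have m4 : m <= t0 by rewrite !ge_min lexx !orbT.
have m5 : m <= v0 by rewrite !ge_min lexx !orbT.
exists (-1 + m); split; [lra|lra| |].
  by have := branch_inv_le br (-1 + m); lra.
move=> x /andP[xl xr]; exists (x + 1); split; [by ring|lra..].
Qed.

(** The regimes differ only in the comparison of the powers p and g of [v]: the condition on [K] can
    be met by one large [K] if [p = g], and by every [K > 0] if [g < p]. *)
Lemma rate_upper : exists C : R, 0 <= C /\ forall K, 0 <= K ->
  (exists d : R, 0 < d /\ forall v, 0 < v -> v < d -> C * v `^ p <= K * v `^ g) ->
  exists r : R, -1 < r /\ forall B : set (measurableTypeR R), measurable B ->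
    B `<=` `]-1, r[%classic -> (mu B <= (K / l1)%:E * lam B)%E.
Proof.
have [x1 [c [C [x10 x11 c0 C0 near1]]]] := mu_near1 br mu1 mu_inv mu_approx.
exists (C * k2); split=> [|K K0 [d [d0 Hd]]]; first by rewrite mulr_ge0// ltW.
have [r [r1 r2 rx Hr]] := range x11 d0.
exists r; split => //.
apply: (mu_nearN1_le br mu1 mu_inv C0 near1 r2 rx).
  by rewrite divr_ge0// ltW.
move=> x /Hr[v [-> v1 v2 v3 v4]].
have /andP[_ h1] := D_opp v1 v2 v3.
have [/andP[h2 _] _] := DN1 v1 v2.
have e1 : C * D (- psi (-1 + v)) <= C * (k2 * v `^ p) by exact: ler_wpM2l.
have e2 : K / l1 * (l1 * v `^ g) <= K / l1 * (1 - D (-1 + v)).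
  by apply: ler_wpM2l => //; rewrite divr_ge0// ltW.
have e3 := Hd v v1 v4.
have e4 : K / l1 * (l1 * v `^ g) = K * v `^ g by rewrite mulrA divfK// gt_eqF.
lra.
Qed.

Lemma rate_lower (M : R) : 0 <= M ->
  (forall C, 0 < C -> exists d : R, 0 < d /\ forall v, 0 < v -> v < d ->
     M * v `^ g <= C * v `^ p) ->
  exists r : R, -1 < r /\ forall B : set (measurableTypeR R), measurable B ->
    B `<=` `]-1, r[%classic -> ((M / l2)%:E * lam B <= mu B)%E.
Proof.
move=> M0 H; have [x1 [c [C [x10 x11 c0 C0 near1]]]] := mu_near1 br mu1 mu_inv mu_approx.
have kp : 0 < k1 * (1 / 2) `^ p by rewrite mulr_gt0// powR_gt0; lra.
(* The division by 2 pays for the factor [D x], which is at least [1 / 2] close to -1. *)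
have ck : 0 < c * (k1 * (1 / 2) `^ p) / 2 by rewrite divr_gt0// mulr_gt0.
have [d [d0 Hd]] := H _ ck.
have l2i : 0 < (2 * l2)^-1 by rewrite invr_gt0 mulr_gt0.
have [d' [d'0 Hd']] := powR_small g0 l2i.
have dd0 : 0 < Num.min d d' by rewrite lt_min d0.
have [r [r1 r2 rx Hr]] := range x11 dd0.
exists r; split => //.
apply: (mu_nearN1_ge br mu1 mu_inv (ltW c0) near1 r2 rx) => //.
  by rewrite divr_ge0// ltW.
move=> x /Hr[v [-> v1 v2 v3]]; rewrite lt_min => /andP[v4 v5].
have /andP[h1 _] := D_opp v1 v2 v3.
have [/andP[_ h2] _] := DN1 v1 v2.
have h3 : l2 * v `^ g <= 1 / 2.
  have := Hd' v v1 v5; rewrite invfM => h.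
  have : l2 * v `^ g <= l2 * (2^-1 * l2^-1) by apply: ler_wpM2l; exact: ltW.
  by rewrite mulrCA divff ?gt_eqF//; lra.
have Dh : 1 / 2 <= D (-1 + v) by lra.
have e1 : M / l2 * (1 - D (-1 + v)) <= M / l2 * (l2 * v `^ g).
  by apply: ler_wpM2l => //; rewrite divr_ge0// ltW.
have e4 : M / l2 * (l2 * v `^ g) = M * v `^ g by rewrite mulrA divfK// gt_eqF.
have e3 := Hd v v1 v4.
have e5 : c * (k1 * (1 / 2) `^ p * v `^ p) * (1 / 2) <=
    c * D (- psi (-1 + v)) * D (-1 + v).
  have a0 : 0 <= c * (k1 * (1 / 2) `^ p * v `^ p).
    by apply: mulr_ge0; [exact: ltW|apply: mulr_ge0; [exact: ltW|exact: powR_ge0]].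
  have h12 : 0 <= 1 / 2 :> R by lra.
  by apply: ler_pM => //; apply: ler_wpM2l => //; exact: ltW.
lra.
Qed.

End neutral_rates.

Lemma powR_dominated (R : realType) (q1 q2 e : R) : q1 < q2 -> 0 < e ->
  exists d : R, 0 < d /\ forall v, 0 < v -> v < d -> v `^ q2 <= e * v `^ q1.
Proof.
move=> q12 e0; have q0 : 0 < q2 - q1 by lra.
have [d [d0 H]] := powR_small q0 e0; exists d; split => // v v0 vd.
have -> : q2 = (q2 - q1) + q1 by ring.
rewrite powRD; last by rewrite (gt_eqF v0) implybT.
by apply: ler_wpM2r; [exact: powR_ge0|exact/ltW/H].
Qed.

(** * From inequalities between measures to bounds almost everywhere *)

Section almost_everywhere.
Context (R : realType).
Notation lam := (@lebesgue_measure R).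
Variables (mu : {measure set (measurableTypeR R) -> \bar R}) (rho : R -> R).
Hypotheses (mrho : measurable_fun setT rho) (rho0 : forall x, 0 <= rho x)
  (mu_rho : forall A : set (measurableTypeR R), measurable A ->
     mu A = (\int[lam]_(x in A) (rho x)%:E)%E).

Let null_of (h : R -> R) (N : set (measurableTypeR R)) : measurable N ->
  measurable_fun N h -> (forall x, N x -> 0 < h x) ->
  (\int[lam]_(x in N) (h x)%:E <= 0)%E -> {ae lam, forall x, ~ N x}.
Proof.
move=> mN mh h0 int0.
have : (\int[lam]_(x in N) `|(h x)%:E| = 0)%E.
  apply/eqP; rewrite eq_le integral_ge0 ?andbT//; apply: le_trans int0.
  apply: ge0_le_integral => //.
  - by apply: measurableT_comp => //; exact/measurable_EFinP.
  - exact/measurable_EFinP.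
  - by move=> x Nx; rewrite lee_fin ger0_norm// ltW// h0.
move=> /(ae_eq_integral_abs _ mN (f := EFin \o h)).
move=> /(_ (ltac:(exact/measurable_EFinP))).
apply: filterS => x hx Nx; have := hx Nx; have := h0 x Nx.
by move=> + [] => /[swap] ->; rewrite ltxx.
Qed.

Let lebesgue_fin (p q : R) (N : set (measurableTypeR R)) : measurable N ->
  N `<=` `]p, q[%classic -> lam N \is a fin_num.
Proof.
move=> mN Npq; rewrite ge0_fin_numE//; apply: (@le_lt_trans _ _ (lam `]p, q[%classic)).
  by apply: le_measure; rewrite ?inE//; exact: measurable_itv.
by rewrite lebesgue_measure_itv/= lte_fin; case: ifP => // _; rewrite -EFinD ltry.
Qed.

(** The part of (p, q) where the bound fails has finite Lebesgue measure, so [e%:E * lam N] can be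
    cancelled; the positive excess [rho x - e] then has integral 0 over it. *)
Lemma ae_density_le (p q e : R) : 0 <= e ->
  (forall B : set (measurableTypeR R), measurable B -> B `<=` `]p, q[%classic ->
     (mu B <= e%:E * lam B)%E) ->
  {ae lam, forall x, p < x < q -> rho x <= e}.
Proof.
move=> e0 H; pose N : set (measurableTypeR R) := `]p, q[%classic `&` [set x | e < rho x].
have mN : measurable N.
  apply: measurableI; first exact: measurable_itv.
  rewrite -[X in measurable X]setTI.
  rewrite (_ : [set x | e < rho x] = rho @^-1` `]e, +oo[%classic).
    by apply: mrho => //; exact: measurable_itv.
  by apply/seteqP; split => x /=; rewrite in_itv/= andbT.
have Npq : N `<=` `]p, q[%classic by move=> x [].
have lN : lam N \is a fin_num by exact: lebesgue_fin Npq.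
have aeN : {ae lam, forall x, ~ N x}.
  apply: (@null_of (fun x => rho x - e)) => //.
  - by apply: measurable_funB => //; exact: measurable_funTS.
  - by move=> x [_ /=]; rewrite subr_gt0.
  have fin : (e%:E * lam N)%E \is a fin_num by rewrite fin_numM.
  rewrite -(leeD2rE _ _ fin) add0e; apply: le_trans (H N mN Npq).
  rewrite mu_rho// -(integral_cst lam mN) -ge0_integralD//.
  - by under eq_integral do rewrite /= -EFinD subrK.
  - by move=> x [_ /= h]; rewrite lee_fin subr_ge0 ltW.
  - by apply/measurable_EFinP; apply: measurable_funB => //; exact: measurable_funTS.
apply: filterS aeN => x Nx xpq; rewrite leNgt; apply/negP => h; apply: Nx.
by split => //=; rewrite in_itv.
Qed.

Lemma ae_density_ge (p q e : R) : 0 <= e ->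
  (forall B : set (measurableTypeR R), measurable B -> B `<=` `]p, q[%classic ->
     (e%:E * lam B <= mu B)%E) ->
  {ae lam, forall x, p < x < q -> e <= rho x}.
Proof.
move=> e0 H; pose N : set (measurableTypeR R) := `]p, q[%classic `&` [set x | rho x < e].
have mN : measurable N.
  apply: measurableI; first exact: measurable_itv.
  rewrite -[X in measurable X]setTI.
  rewrite (_ : [set x | rho x < e] = rho @^-1` `]-oo, e[%classic).
    by apply: mrho => //; exact: measurable_itv.
  by apply/seteqP; split => x /=; rewrite in_itv.
have Npq : N `<=` `]p, q[%classic by move=> x [].
have lN : lam N \is a fin_num by exact: lebesgue_fin Npq.
have aeN : {ae lam, forall x, ~ N x}.
  apply: (@null_of (fun x => e - rho x)) => //.
  - by apply: measurable_funB => //; exact: measurable_funTS.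
  - by move=> x [_ /=]; rewrite subr_gt0.
  have fin : mu N \is a fin_num.
    rewrite ge0_fin_numE//; apply: (@le_lt_trans _ _ (e%:E * lam N)%E); last first.
      by rewrite -ge0_fin_numE ?fin_numM// mule_ge0.
    rewrite mu_rho// -(integral_cst lam mN); apply: ge0_le_integral => //.
    - by move=> x _; rewrite lee_fin.
    - by apply/measurable_EFinP; exact: measurable_funTS.
    - by move=> x [_ /= h]; rewrite lee_fin ltW.
  rewrite -(leeD2rE _ _ fin) add0e; apply: le_trans (H N mN Npq).
  rewrite mu_rho// -(integral_cst lam mN) -ge0_integralD//.
  - by under eq_integral do rewrite /= -EFinD subrK.
  - by move=> x [_ /= h]; rewrite lee_fin subr_ge0 ltW.
  - by apply/measurable_EFinP; apply: measurable_funB => //; exact: measurable_funTS.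
  - by move=> x _; rewrite lee_fin.
  - by apply/measurable_EFinP; exact: measurable_funTS.
apply: filterS aeN => x Nx xpq; rewrite leNgt; apply/negP => h; apply: Nx.
by split => //=; rewrite in_itv.
Qed.

End almost_everywhere.

(** * Application to the class of maps *)

Lemma cusp_map_branch (R : realType) (kappa gamma a b : R) (S : R -> R) :
  0 < kappa < 1 -> 1 < gamma -> 0 < a -> 0 < b ->
  parabolic_cusp_map kappa gamma a b S ->
  exists sigma psi D : R -> R, [/\ cusp_branch sigma psi D,
    forall y, -1 <= y <= 0 -> sigma y = S y,
    exists k1 k2 t0 : R, [/\ 0 < k1, 0 < k2, 0 < t0 &
      forall t, 0 < t -> t < t0 ->
        k1 * t `^ (kappa^-1 - 1) <= D (1 - t) <= k2 * t `^ (kappa^-1 - 1)] &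
    exists l1 l2 v0 : R, [/\ 0 < l1, 0 < l2, 0 < v0 &
      forall v, 0 < v -> v < v0 ->
        l1 * v `^ (gamma - 1) <= 1 - D (-1 + v) <= l2 * v `^ (gamma - 1) /\
        v / 2 <= 1 + psi (-1 + v) <= v]].
Proof.
move=> /andP[k0 k1] g1 a0 b0 map.
have incr := left_increasing map.
have chord x y z : -1 < x -> x < y -> y < z -> z < 0 ->
    (S y - S x) * (z - y) <= (S z - S y) * (y - x).
  move=> x1 xy yz z0; have zx : 0 < z - x by lra.
  pose t := (z - y) / (z - x).
  have t0 : 0 <= t by rewrite divr_ge0; lra.
  have t1 : t <= 1 by rewrite ler_pdivrMr//; lra.
  have xD : x \in (`]-1, 0[%classic : set R) by rewrite inE /= in_itv/=; lra.
  have zD : z \in (`]-1, 0[%classic : set R) by rewrite inE /= in_itv/=; lra.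
  have h := left_convex map (Itv01 t0 t1) xD zD.
  have ty : t * x + (1 - t) * z = y by rewrite /t; field; rewrite gt_eqF.
  have {}h : S y <= t * S x + (1 - t) * S z by rewrite -{1}ty; exact: h.
  have : S y * (z - x) <= (t * S x + (1 - t) * S z) * (z - x) by rewrite ler_pM2r.
  have -> : (t * S x + (1 - t) * S z) * (z - x) = (z - y) * S x + (y - x) * S z.
    by rewrite /t; field; rewrite gt_eqF.
  lra.
have [d [d0 Hd]] : exists d : R, 0 < d /\ forall y, - d < y -> y < 0 ->
    b * (- y) `^ kappa / 2 <= 1 - S y <= 2 * (b * (- y) `^ kappa).
  have g0 (x : R) : 0 <= b * `|x| `^ kappa by rewrite mulr_ge0 ?powR_ge0// ltW.
  have /near_dnbhs0[d [d0 H]] := equiv_bounds g0 (equiv_at_0 map).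
  exists d; split => // y yd y0; have := H y; rewrite (ltr0_norm y0); apply; lra.
have [d' [d'0 Hd']] : exists d : R, 0 < d /\ forall y, -1 < y -> y < -1 + d ->
    a * (y + 1) `^ gamma / 2 <= S y - y <= 2 * (a * (y + 1) `^ gamma).
  have g0 (x : R) : 0 <= a * `|x + 1| `^ gamma by rewrite mulr_ge0 ?powR_ge0// ltW.
  have /near_right[e [e0 H]] := equiv_bounds g0 (equiv_at_N1 map).
  exists e; split => // y y1 y2; have := H y y1 y2.
  by rewrite ger0_norm//; lra.
have above e : 0 < e -> exists y, [/\ -1 < y, y < -1 + e, y < 0 & y < S y].
  move=> e0; pose m := Num.min (Num.min e d') 1.
  have m0 : 0 < m by rewrite !lt_min e0 d'0 ltr01.
  have m1 : m <= e by rewrite !ge_min lexx.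
  have m2 : m <= d' by rewrite !ge_min lexx orbT.
  have m3 : m <= 1 by rewrite !ge_min lexx orbT.
  exists (-1 + m / 2); split; try lra.
  have /andP[h _] := Hd' (-1 + m / 2) (ltac:(lra)) (ltac:(lra)).
  rewrite -subr_gt0; apply: lt_le_trans h.
  by rewrite divr_gt0// mulr_gt0// powR_gt0//; lra.
have cusp e : 0 < e -> exists y, [/\ -1 < y, y < 0 & - y <= e * (1 - S y)].
  move=> e0; have k10 : 0 < 1 - kappa by lra.
  (* Since [kappa < 1], a small [w] equals its power [1 - kappa] times its power [kappa], hence is
     at most [e * b / 2] times the latter, and so at most [e * (1 - S (- w))]. *)
  have eb0 : 0 < e * b / 2 by rewrite divr_gt0// mulr_gt0.
  have [c [c0 Hc]] := powR_small k10 eb0.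
  pose m := Num.min (Num.min c d) 1.
  have m0 : 0 < m by rewrite !lt_min c0 d0 ltr01.
  have m1 : m <= c by rewrite !ge_min lexx.
  have m2 : m <= d by rewrite !ge_min lexx orbT.
  have m3 : m <= 1 by rewrite !ge_min lexx orbT.
  exists (- (m / 2)); split; try lra.
  have /andP[h _] := Hd (- (m / 2)) (ltac:(lra)) (ltac:(lra)).
  rewrite opprK in h *.
  have w0 : 0 < m / 2 by lra.
  have hc := ltW (Hc (m / 2) w0 (ltac:(lra))).
  have wE : m / 2 = (m / 2) `^ (1 - kappa) * (m / 2) `^ kappa.
    by rewrite -powRD ?subrK ?powRr1 ?(ltW w0)// (gt_eqF w0) implybT.
  have e1 := ler_wpM2r (powR_ge0 (m / 2) kappa) hc.
  have e2 := ler_wpM2l (ltW e0) h.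
  lra.
have br := build_branch (left_onto map) incr chord above cusp.
set sigma := sigma_of S in br.
set psi := psi_of (left_onto map) in br.
set D := slope_of (left_onto map) in br.
have sE y : -1 <= y <= 0 -> sigma y = S y.
  by move=> /andP[y1 y0]; exact: sigma_in.
exists sigma, psi, D; split => //.
- have [|c1 [c2 [t0 [c10 c20 t00 _ H]]]] := slope_asymptotics_1 br k0 b0 d0.
    by move=> y yd y0 y1; rewrite sE ?y1 ?(ltW y0)//; exact: Hd.
  by exists c1, c2, t0; split.
- have [|c1 [c2 [t0 [c10 c20 t00 _ H]]]] := slope_asymptotics_N1 br g1 a0 d'0.
    by move=> y y1 yd y0; rewrite sE ?(ltW y1) ?y0//; exact: Hd'.
  by exists c1, c2, t0; split.
Qed.

Section invariant_measure.
Context (R : realType) (S sigma psi D : R -> R) (rho : R -> R).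
Variable mu : probability (measurableTypeR R) R.
Hypotheses (br : cusp_branch sigma psi D)
  (sE : forall y, -1 <= y <= 0 -> sigma y = S y)
  (symS : {in `[-1, 1], forall x, S (- x) = S x})
  (mu_acip : acip S mu).
Let O : set (measurableTypeR R) := `]-1, 1[%classic.

(** The end points are null by absolute continuity, so test sets may avoid the fixed point -1 and
    the cusp value 1. *)
Lemma acip_open : mu O = 1%E.
Proof.
have [muE _ dom] := mu_acip.
have mu0 (x : R) : mu [set x] = 0%E.
  move/null_content_dominatesP : dom; apply => //.
  exact: lebesgue_measure_set1.
have mO : measurable O by exact: measurable_itv.
apply/eqP; rewrite eq_le; apply/andP; split.
  rewrite -muE; apply: le_measure; rewrite ?inE//.
  by move=> x; rewrite /O/= !in_itv/= => /andP[/ltW -> /ltW ->].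
pose T : set (measurableTypeR R) := [set -1] `|` [set 1].
have mT : measurable T by exact: measurableU.
have muT : mu T = 0%E.
  apply/eqP; rewrite eq_le measure_ge0 andbT.
  apply: (@le_trans _ _ (mu [set (-1)%R] + mu [set 1%R])%E); first exact: measureU2.
  by rewrite !mu0 adde0.
rewrite -muE; apply: (@le_trans _ _ (mu (O `|` T))).
  apply: le_measure; rewrite ?inE//; first exact: measurableU.
  move=> x; rewrite /O/T/= !in_itv/= => /andP[]; rewrite !le_eqVlt.
  by move=> /predU1P[<-|->] /predU1P[->|->] /=; [right; left|right; left|right; right|left].
apply: (@le_trans _ _ (mu O + mu T)%E); first exact: measureU2.
by rewrite muT adde0.
Qed.

Lemma acip_preim (B : set (measurableTypeR R)) : measurable B -> B `<=` O ->
  mu B = mu (preim_left sigma B `|` preim_right sigma B).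
Proof.
move=> mB BO; have [_ inv _] := mu_acip; rewrite -(inv B mB); congr (mu _).
apply/seteqP; split => y; rewrite /preim_left/preim_right /=.
- rewrite in_itv/= => -[/andP[y1 y2] By].
  have [y0|y0] := leP y 0; [left|right]; rewrite /preim_left /=.
    by rewrite sE y1 ?y0.
  rewrite sE; last by lra.
  rewrite symS ?in_itv/= ?y1//; split => //; lra.
- case=> -[/andP[y1 y0]]; rewrite sE ?y1 ?y0// => By.
    by rewrite in_itv/=; split => //; lra.
  rewrite /= in_itv/=; split; first by move: y1 y0 => /=; lra.
  by rewrite symS in By => //; rewrite in_itv/=; move: y1 y0 => /=; lra.
Qed.

End invariant_measure.

Lemma ess_near (R : realType) (F : set_system R) (p q : R) (P : R -> Prop) :
  (\forall x \near F, p < x < q) ->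
  {ae @lebesgue_measure R, forall x, p < x < q -> P x} -> \forall x \near ess F, P x.
Proof. by move=> FB AB; exists [set x | p < x < q]. Qed.

Lemma near_left_itv (R : realType) (p q : R) : p < q -> \forall x \near q^'-, p < x < q.
Proof.
move=> pq; near=> x; apply/andP; split; near: x; [exact: nbhs_left_gt|exact: nbhs_left_lt].
Unshelve. all: by end_near. Qed.

Lemma near_right_itv (R : realType) (p q : R) : p < q -> \forall x \near p^'+, p < x < q.
Proof.
move=> pq; near=> x; apply/andP; split; near: x; [exact: nbhs_right_gt|exact: nbhs_right_lt].
Unshelve. all: by end_near. Qed.

Theorem proposition15 (R : realType) (kappa gamma a b : R) (S : R -> R)
    (mu : probability (measurableTypeR R) R) (rho : R -> R)
    (kappa01 : 0 < kappa < 1) (gamma_gt1 : 1 < gamma)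
    (a_gt0 : 0 < a) (b_gt0 : 0 < b)
    (kappa_lt : gamma <= 2 \/ kappa < 1 / (gamma - 1))
    (mapS : parabolic_cusp_map kappa gamma a b S)
    (mu_acip : acip S mu) (rho_density : is_density mu rho) :
  [/\ rho x @[x --> ess (1^'-)] --> 0,
      [/\ kappa = 1 / gamma -> rho =O_ (ess ((-1)^'+)) (cst (1 : R)),
          1 / gamma < kappa -> rho x @[x --> ess ((-1)^'+)] --> +oo
        & kappa < 1 / gamma -> rho x @[x --> ess ((-1)^'+)] --> 0]
    & of_order_one (ess (nbhs 0)) rho ].
Proof.
have [sigma [psi [D [br sE [k1 [k2 [t0 [k10 k20 t00 D1]]]] [l1 [l2 [v0 [l10 l20 v00 DN1]]]]]]]] :=
  cusp_map_branch kappa01 gamma_gt1 a_gt0 b_gt0 mapS.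
have [mrho rho0 mu_rho] := rho_density.
have muE : mu `[-1, 1]%classic = 1%E by case: mu_acip.
have mu1 := acip_open mu_acip.
have mu_inv := acip_preim sE (branches_symmetric mapS) mu_acip.
have mu_app := mu_approx mrho rho0 muE mu_rho.
have /andP[k0 kk1] := kappa01.
have p0 : 0 < kappa^-1 - 1 by rewrite subr_gt0 invf_gt1.
have g0 : 0 < gamma - 1 by rewrite subr_gt0.
have gp : 0 < gamma by lra.
have [C [C0 upper]] := rate_upper br mu1 mu_inv mu_app p0 k10 k20 t00 l10 v00 D1 DN1.
have lower := rate_lower br mu1 mu_inv mu_app p0 g0 k10 k20 t00 l20 v00 D1 DN1.
split; [|split|].
- apply/cvgrPdist_le => e e0.
  have [x1 [x11 H]] := mu_near1_le br mu1 mu_inv mu_app e0.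
  have := ess_near (near_left_itv x11) (ae_density_le mrho mu_rho (ltW e0) H).
  by apply: filterS => x rx; rewrite sub0r normrN ger0_norm.
- move=> kE.
  have pE : kappa^-1 - 1 = gamma - 1 by rewrite kE div1r invrK.
  (* Here both powers coincide, so any [K >= C] is admissible; [C + 1] is moreover positive. *)
  have C10 : 0 < C + 1 by lra.
  have [|r [r1 H]] := upper _ (ltW C10).
    exists 1; split => // v v1 v2; rewrite pE; have := powR_ge0 v (gamma - 1); lra.
  apply/eqO_exP; exists ((C + 1) / l1); first exact: divr_gt0.
  have := ess_near (near_right_itv r1)
    (ae_density_le mrho mu_rho (ltW (divr_gt0 C10 l10)) H).
  by apply: filterS => x rx; rewrite normr1 mulr1 ger0_norm.
- move=> kg; apply/cvgryPge => A.
  have p_lt : kappa^-1 - 1 < gamma - 1.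
    by rewrite ltrD2r invf_plt ?posrE// -div1r.
  (* [M] is positive even if [A] is not; the factor [l2] below cancels the denominator in
     [rate_lower]. *)
  pose M := Num.max A 1.
  have M0 : 0 < M by rewrite lt_max ltr01 orbT.
  have [|c c0|r [r1 H]] := lower (M * l2); first by rewrite mulr_ge0// ltW.
    have [d [d0 Hd]] := powR_dominated p_lt (divr_gt0 c0 (mulr_gt0 M0 l20)).
    exists d; split => // v v1 v2; have := Hd v v1 v2.
    by rewrite mulrAC ler_pdivlMr ?mulr_gt0// mulrC.
  rewrite mulfK ?gt_eqF// in H.
  have := ess_near (near_right_itv r1) (ae_density_ge mrho rho0 mu_rho (ltW M0) H).
  by apply: filterS => x; apply: le_trans; rewrite le_max lexx.
- move=> kg; apply/cvgrPdist_le => e e0.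
  have p_lt : gamma - 1 < kappa^-1 - 1.
    by rewrite ltrD2r invf_pgt ?posrE// -div1r.
  have [||r [r1 H]] := upper (e * l1); first by rewrite mulr_ge0// ltW.
    have C10 : 0 < C + 1 by lra.
    have [d [d0 Hd]] := powR_dominated p_lt (divr_gt0 (mulr_gt0 e0 l10) C10).
    exists d; split => // v v1 v2; have := Hd v v1 v2.
    rewrite mulrAC ler_pdivlMr// => h.
    have := powR_ge0 v (kappa^-1 - 1); lra.
  rewrite mulfK ?gt_eqF// in H.
  have := ess_near (near_right_itv r1) (ae_density_le mrho mu_rho (ltW e0) H).
  by apply: filterS => x rx; rewrite sub0r normrN ger0_norm.
- have [d [c [C' [d0 d1 c0 C'0 H]]]] := mu_around0 br mu1 mu_inv mu_app.
  exists c, C'; split => //.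
  have nd : \forall x \near (0 : R), - d < x < d.
    by apply/nbhs_ballP; exists d => //= x; rewrite /ball/= sub0r normrN ltr_norml.
  have Hge : forall B : set (measurableTypeR R), measurable B -> B `<=` `]- d, d[%classic ->
    (c%:E * lebesgue_measure B <= mu B)%E by move=> B mB /(H B mB)[].
  have Hle : forall B : set (measurableTypeR R), measurable B -> B `<=` `]- d, d[%classic ->
    (mu B <= C'%:E * lebesgue_measure B)%E by move=> B mB /(H B mB)[].
  have := ess_near nd (ae_density_le mrho mu_rho C'0 Hle).
  have := ess_near nd (ae_density_ge mrho rho0 mu_rho (ltW c0) Hge).
  by apply: filterS2 => x h1 h2; rewrite h1.
Qed.
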